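(* Let $R$ be a countable $\aleph_0$-categorical relational structure with domain $E$. Then the number $\mathrm{sib}(R)$ of siblings of $R$, counted up to isomorphism, is either one or infinite. Furthermore, $\mathrm{sib}(R)=1$ if and only if $R$ is finitely partitionable, that is, there is a partition of $E$ into finitely many sets such that every permutation of $E$ which preserves each block of the partition is an automorphism of $R$.
   Context: A relational structure with domain $E$ is $R=(E,(\rho_i)_{i\in I})$ where each $\rho_i\subseteq E^{n_i}$ is an $n_i$-ary relation; its signature is $(n_i)_{i\in I}$. For $A\subseteq E$, the restriction is $R_{\restriction A}=(A,(A^{n_i}\cap\rho_i)_{i\in I})$. A structure $S$ of the same signature embeds into $R$ if $S$ is isomorphic to some restriction of $R$. A sibling of $R$ is a structure $S$ such that $S$ embeds into $R$ and $R$ embeds into $S$; $\mathrm{sib}(R)$ is the number of isomorphism classes of siblings of $R$. A countable $R$ is $\aleph_0$-categorical if its complete first-order theory has, up to isomorphism, exactly one countable model; as in the Engeler–Ryll-Nardzewski–Svenonius theorem, this is taken to be equivalent to $\mathrm{Aut}(R)$ being oligomorphic, i.e. for every integer $n$ the number of $\mathrm{Aut}(R)$-orbits of $n$-element subsets of $E$ is finite. *)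

(* Defs.v *)
From mathcomp Require Import all_boot.
From mathcomp Require Import boolp classical_sets functions cardinality.
Set Implicit Arguments.
Unset Strict Implicit.
Unset Printing Implicit Defensive.
Local Open Scope classical_set_scope.

(* The signature is ar : I -> nat; the domain may be empty. *)
Record structure (I : Type) (ar : I -> nat) := Structure {
  dom : Type;
  rel : forall i : I, set ((ar i).-tuple dom) }.
Arguments rel {I ar} _ i _.

Section Siblings.
Variables (I : Type) (ar : I -> nat).
Implicit Types R S T : structure ar.

(* sig rather than set_type: sib below is a set of sets of structures, whose
   cardinality is itself defined through set_type, and using set_type here as
   well would make the universe constraints inconsistent. *)
Definition restriction R (A : set (dom R)) : structure ar :=
  @Structure I ar {x : dom R | A x}
    (fun i => [set t | rel R i (map_tuple (@proj1_sig (dom R) A) t)]).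

Definition is_isomorphism R S (f : dom R -> dom S) : Prop :=
  bijective f /\
  forall (i : I) (t : (ar i).-tuple (dom R)), rel R i t <-> rel S i (map_tuple f t).

Definition isomorphic R S : Prop := exists f : dom R -> dom S, is_isomorphism f.

Definition is_automorphism R (f : dom R -> dom R) : Prop :=
  @is_isomorphism R R f.

Definition embeds S R : Prop :=
  exists A : set (dom R), isomorphic S (restriction A).

Definition sibling R S : Prop := embeds S R /\ embeds R S.

Definition iso_class S : set (structure ar) := [set T | isomorphic S T].

(* The set of isomorphism classes of siblings; sib(R) is its cardinality. *)
Definition sib R : set (set (structure ar)) :=
  [set iso_class S | S in [set S | sibling R S]].

Definition finitely_partitionable R : Prop :=
  exists P : set (set (dom R)),
    [/\ finite_set P, partition P id [set: dom R] &
        forall f : dom R -> dom R, bijective f ->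
          (forall B, P B -> f @` B = B) -> is_automorphism f].

(* The relations of R, each tagged with its arity, as a set: equal relations
   carrying different indices are counted once. Engeler-Ryll-Nardzewski-Svenonius
   needs countably many relations (a structure with oligomorphic automorphism
   group has no more): nat with all relations of all arities is the only
   countable model of its theory, yet it is rigid. *)
Definition relations R : set {n : nat & set (n.-tuple (dom R))} :=
  [set existT (fun n => set (n.-tuple (dom R))) (ar i) (rel R i)
     | i in [set: I]].

(* First-order formulas with equality whose free variables are among n de
   Bruijn indices. Variables range over 'I_n, so sentences (n = 0) can also be
   evaluated in a structure with empty domain. *)
Inductive formula : nat -> Type :=
| Fbot n : formula n
| Feq n (x y : 'I_n) : formula n
| Frel n (i : I) (v : (ar i).-tuple 'I_n) : formula n
| Fimp n (p q : formula n) : formula n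
| Fall n (p : formula n.+1) : formula n.

Fixpoint holds R n (p : formula n) : n.-tuple (dom R) -> Prop :=
  match p in formula n return n.-tuple (dom R) -> Prop with
  | Fbot n => fun _ => False
  | Feq n x y => fun e => tnth e x = tnth e y
  | Frel n i v => fun e => rel R i (map_tuple (tnth e) v)
  | Fimp n p q => fun e => holds p e -> holds q e
  | Fall n p => fun e => forall a : dom R, holds p (cons_tuple a e)
  end.

Definition satisfies R (p : formula 0) : Prop := holds p ([tuple] : 0.-tuple (dom R)).

Definition theory R : set (formula 0) := [set p | satisfies R p].

Definition models S (Th : set (formula 0)) : Prop :=
  forall p, Th p -> satisfies S p.

Definition aleph0_categorical R : Prop :=
  exists M : structure ar,
    [/\ countable [set: dom M], models M (theory R) &
        forall S, countable [set: dom S] -> models S (theory R) ->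
          isomorphic M S].

End Siblings.

Arguments relations {I ar} R _.

(* Main.v *)
Require Import Defs.
From mathcomp Require Import all_boot.
From mathcomp Require Import boolp classical_sets functions cardinality.
From mathcomp Require Import filter.
Set Implicit Arguments.
Unset Strict Implicit.
Unset Printing Implicit Defensive.
Local Open Scope classical_set_scope.
Local Open Scope card_scope.

(** Write [E] for the domain of [R]. Call [x] and [y] twins when the transposition
    of [x] and [y] is an automorphism. This is an equivalence relation, and a map
    that moves each point to a twin preserves all relations as soon as it is
    injective, because on a finite set it agrees with a composite of such
    transpositions ([twin_injection]). Hence [R] is finitely partitionable exactly
    when it has finitely many classes of twins ([finitely_partitionableP]).

    If there are finitely many classes, an embedding of [R] into its restriction to
    [A] permutes them, so a power [g] of it fixes each class. The Cantor-Bernstein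
    bijection from [E] to [A] built from [g] and from the inclusion of [A] moves
    points to twins, so it is an isomorphism ([embedding_onto]): every sibling is
    isomorphic to [R].

    Now suppose that there are infinitely many classes. Categoricity gives an
    oligomorphic automorphism group ([ryll_nardzewski]); all that follows is
    combinatorics of orbits. By Ramsey's theorem there are a copy [e E] of [R]
    inside [E], sitting there like an elementary substructure, and a sequence [c]
    that is order-indiscernible over it and none of whose terms is a twin of a
    point of the copy ([limit_sequence]). Adding the first [n] terms of [c] to the
    copy gives siblings of [R], and they have to be told apart.

    The invariant is the set of sizes of the finite components of the following
    graph: two points are adjacent when no tuple of other points distinguishes
    them. Consecutive terms of [c] are adjacent, whether or not [c] behaves as a
    chain, so the [n] new points lie in one component. On the other hand a point
    of infinite degree is a twin of its neighbours ([infinite_degree_twin]), so in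
    an oligomorphic structure a component is either an infinite class of twins or
    finite of bounded size ([component_dichotomy], [component_bound]). Therefore
    the sibling with [n] new points has a component of size about [n] and all its
    other finite components are small ([ext_large_component]), unless the new
    points are swallowed by an infinite class of twins of the copy. In this
    exceptional case that class can be replaced by [c], so [R] embeds into the
    complement of an infinite class of twins ([bad_removable]); then one keeps
    just [n] points of that class, and they form a component of size [n]
    ([trim_large_component]). Either way infinitely many siblings result.

    For the Ryll-Nardzewski theorem, let every countable model of the theory of
    [R] be isomorphic to [R]. A countable set of formulas in [n] variables that is
    finitely satisfiable in [R] is realized in a countable model made of a
    Skolem-closed family of sequences modulo an ultrafilter, hence in [R]
    ([realize_type]). It follows that isolated types are dense, for otherwise a
    diagonal argument yields a set of formulas that no tuple of [R] realizes
    ([dense_isolated]). A Tarski-Vaught construction then produces an elementary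
    substructure all of whose tuples are isolated; being isomorphic to it, [R]
    has only isolated types, hence finitely many in each number of variables, and
    tuples of the same type are conjugate by back and forth. *)

(** * Countable constructions and Ramsey's theorem *)

Lemma dependent_choice_seq (X : Type) (inv : seq X -> Prop)
    (P : seq X -> X -> Prop) :
  inv [::] -> (forall l, inv l -> exists2 x, P l x & inv (rcons l x)) ->
  exists F : nat -> X, forall m, inv (mkseq F m) /\ P (mkseq F m) (F m).
Proof.
move=> inv0 invS; have [x0 _ _] := invS _ inv0.
have /choice[g gP] l : exists x, inv l -> P l x /\ inv (rcons l x).
  have [/invS[x Px ix]|nl] := pselect (inv l); first by exists x.
  by exists x0 => /nl.
pose pre := fix pre m := if m is k.+1 then rcons (pre k) (g (pre k)) else [::].
have preE m : pre m = mkseq (fun j => g (pre j)) m.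
  elim: m => //= m IH; by rewrite mkseqS -IH.
have preI m : inv (pre m) by elim: m => //= m /gP[].
exists (fun j => g (pre j)) => m; rewrite -preE; split => //.
by have [] := gP _ (preI m).
Qed.

Lemma dependent_choice_step (X : Type) (inv : nat -> X -> Prop)
    (P : nat -> X -> X -> Prop) :
  (exists x, inv 0 x) ->
  (forall n x, inv n x -> exists2 y, inv n.+1 y & P n x y) ->
  exists F : nat -> X, forall n, inv n (F n) /\ P n (F n) (F n.+1).
Proof.
move=> [x0 inv0] invS.
have /choice[next hnext] (p : nat * X) :
    exists y, inv p.1 p.2 -> inv p.1.+1 y /\ P p.1 p.2 y.
  have [/invS[y]|no] := pselect (inv p.1 p.2); first by exists y.
  by exists x0 => /no.
pose F := fix F n := if n is m.+1 then next (m, F m) else x0.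
have Finv n : inv n (F n) by elim: n => //= n /(hnext (n, _))[].
by exists F => n; split => //; have [] := hnext (n, F n) (Finv n).
Qed.

Lemma seq_bound (T : eqType) (h : T -> nat) (s : seq T) :
  exists B, forall z, z \in s -> h z < B.
Proof.
exists (\max_(z <- s) h z).+1 => z zs; rewrite ltnS.
by rewrite (big_rem z) //= leq_maxl.
Qed.

Lemma partial_inverse (X Y : Type) (x0 : X) (h : X -> Y) : injective h ->
  exists g : Y -> X, cancel h g.
Proof.
move=> h_inj; have /choice[g hg] y : exists x, forall x', h x' = y -> x = x'.
  have [[x <-]|no] := pselect (exists x, h x = y).
    by exists x => x' /h_inj.
  by exists x0 => x' hx'; case: no; exists x'.
by exists g => x; apply: hg.
Qed.

Lemma pickle_unbounded (K : countType) (k : K) B : exists p : nat,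
  B <= pickle (k, p).
Proof.
apply: contrapT => /forallNP no.
have f_lt (i : 'I_B.+1) : pickle (k, nat_of_ord i) < B.
  by rewrite ltnNge; apply/negP.
have inj : injective (fun i => Ordinal (f_lt i)).
  by move=> i j [] /(pcan_inj pickleK) [] /val_inj.
by have := leq_card _ inj; rewrite !card_ord ltnn.
Qed.

(** Stage [m] applies the operation coded by [m] to earlier terms. Every pair
    [(k, s)] has infinitely many codes, so one of them comes after all the
    indices in [s]. *)
Lemma closed_enumeration (X : Type) (x0 : X) (K : countType)
    (op : K -> seq X -> X) :
  exists F : nat -> X, forall k s, exists m, F m = op k (map F s).
Proof.
pose g (l : seq X) :=
  if @unpickle (K * seq nat * nat)%type (size l) is Some (k, s, _)
  then op k [seq nth x0 l j | j <- s] else x0.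
have [F FP] := @dependent_choice_seq X (fun=> True) (fun l x => x = g l) I
  (fun l _ => ex_intro2 _ _ (g l) erefl I).
exists F => k s.
have [B sB] := seq_bound id s; have [p Bp] := pickle_unbounded (k, s) B.
have hp : all (fun j => j < pickle (k, s, p)) s.
  by apply/allP => j /sB jB; apply: leq_trans Bp.
exists (pickle (k, s, p)).
have [_ ->] := FP (pickle (k, s, p)); rewrite /g size_mkseq pickleK.
congr op; apply/eq_in_map => j js; rewrite nth_mkseq //.
exact: (allP hp).
Qed.

Definition increasing (g : nat -> nat) := {homo g : i j / i < j}.

Lemma increasing_comp f g : increasing f -> increasing g -> increasing (f \o g).
Proof. by move=> fi gi i j /gi /fi. Qed.

Lemma increasing_succ : increasing S.
Proof. by []. Qed.

Lemma increasing_le f i : increasing f -> i <= f i.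
Proof.
by move=> fi; elim: i => // i IH; apply: leq_ltn_trans IH (fi _ _ _).
Qed.

Lemma increasingS (f : nat -> nat) : (forall i, f i < f i.+1) -> increasing f.
Proof. by move=> fS; apply: homo_ltn => //; apply: ltn_trans. Qed.

Lemma infinite_pigeonhole k (c : nat -> nat) : (forall i, c i < k) ->
  exists g, increasing g /\ exists v, forall i, c (g i) = v.
Proof.
move=> ck.
have [v hv] : exists v, forall N, exists2 i, N < i & c i = v.
  elim: k c ck => [c /(_ 0)//|k IH c ck].
  have [hk|/existsNP[N hN]] := pselect (forall N, exists2 i, N < i & c i = k).
    by exists k.
  have /IH[v hv] : forall i, c (N.+1 + i) < k.
    move=> i; have := ck (N.+1 + i); rewrite ltnS leq_eqVlt => /orP[/eqP ci|//].
    by case: hN; exists (N.+1 + i) => //; rewrite leq_addr.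
  exists v => M; have [i Mi ci] := hv M; exists (N.+1 + i) => //.
  exact: leq_trans Mi (leq_addl _ _).
have [F FP] := @dependent_choice_seq nat (fun=> True)
  (fun l x => last 0 l < x /\ c x = v) I
  (fun l _ => let: ex_intro2 x hx cx := hv (last 0 l) in
     ex_intro2 _ _ x (conj hx cx) I).
exists F; split; last by exists v => i; have [_ []] := FP i.
apply: increasingS => i; have [_ [+ _]] := FP i.+1.
by rewrite mkseqS last_rcons.
Qed.

(** Infinite Ramsey theorem for increasing [m]-tuples, these being the initial
    segments [mkseq f m] of increasing functions [f], so that homogeneity for [m]
    also speaks of shorter tuples. *)
Lemma ramsey m k (col : seq nat -> nat) : (forall s, col s < k) ->
  exists2 g, increasing g & exists v, forall f, increasing f ->
    col (map g (mkseq f m)) = v.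
Proof.
elim: m col => [col _|m IH col ck]; first by exists id => //; exists (col [::]).
have IH' (a : nat) (g : nat -> nat) : increasing g ->
  exists h : nat -> nat, increasing h /\
     exists v, forall f, increasing f -> col (a :: map (g \o h) (mkseq f m)) = v.
  move=> gi; have [|h hi [v hv]] := IH (fun s => col (a :: map g s)).
    by move=> s; apply: ck.
  by exists h; split => //; exists v => f /hv; rewrite -map_comp.
(* [x.1] is the next term; later terms are drawn from the reservoir [x.2] above it *)
pose homog (x : nat * (nat -> nat)) := [/\ increasing x.2, x.1 < x.2 0 &
  exists v, forall f, increasing f -> col (x.1 :: map x.2 (mkseq f m)) = v].
pose next (x y : nat * (nat -> nat)) := y.1 = x.2 0 /\
  exists2 h, increasing h & y.2 =1 x.2 \o h.
have extend a g : increasing g -> a < g 0 -> exists h, increasing h /\ homog (a, g \o h).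
  move=> gi ag; have [h [hi hv]] := IH' a g gi; exists h; split => //.
  split => //; first exact: increasing_comp.
  apply: leq_trans ag _ => /=.
  by case: (h 0) => // j; apply/ltnW/gi.
have nextE x : homog x -> exists2 y, homog y & next x y.
  move=> [xi _ _].
  have [|h [hi hh]] := extend (x.2 0) _ (increasing_comp xi increasing_succ).
    exact: xi.
  exists (x.2 0, (x.2 \o S) \o h); first exact: hh.
  split => //; exists (S \o h) => //; exact: increasing_comp increasing_succ hi.
have [x0 hx0] : exists x, homog x.
  by have [//|h [_ hh]] := extend 0 _ increasing_succ; exists (0, S \o h).
have [F FP] : exists F : nat -> nat * (nat -> nat), forall i,
    homog (F i) /\ next (F i) (F i.+1).
  apply: (@dependent_choice_step _ (fun=> homog) (fun=> next)); first by exists x0.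
  by move=> _; apply: nextE.
pose a i := (F i).1; pose g i := (F i).2.
have aS i : a i.+1 = g i 0 by have [_ []] := FP i.
have a_incr : increasing a.
  by apply: increasingS => i; rewrite aS; have [[]] := FP i.
have gS i : exists2 h, increasing h & g i.+1 =1 g i \o h by have [_ []] := FP i.
have a_reservoir i d : exists j, a (i + d).+1 = g i j.
  elim: d i => [|d IHd] i; first by exists 0; rewrite addn0 aS.
  have [j] := IHd i.+1; rewrite addSn -addnS => ->.
  by have [h _ ->] := gS i; exists (h j).
have /choice[v hv] i : exists v, forall f, increasing f ->
    col (a i :: map (g i) (mkseq f m)) = v by have [[]] := FP i.
have colv f : increasing f -> col (map a (mkseq f m.+1)) = v (f 0).
  move=> fi; rewrite /mkseq /= -[iota 1 m]/(iota (1 + 0) m) iotaDl -!map_comp.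
  have /choice[p hp] l : exists j, a (f l.+1) = g (f 0) j.
    have -> : f l.+1 = (f 0 + (f l.+1 - f 0).-1).+1.
      by rewrite -addnS prednK ?subnKC ?subn_gt0 ?fi // ltnW // fi.
    exact: a_reservoir.
  have pi : increasing p.
    apply: increasingS => l; have gi : increasing (g (f 0)) by have [[]] := FP (f 0).
    rewrite ltnNge; apply/negP; rewrite leq_eqVlt => /orP[/eqP pe|/gi].
      by have := a_incr _ _ (fi _ _ (ltnSn l.+1)); rewrite !hp pe ltnn.
    by rewrite -!hp ltnNge ltnW // a_incr // fi.
  rewrite -(hv (f 0) _ pi) /mkseq -map_comp; congr (col (_ :: _)).
  by apply: eq_map => l /=; rewrite -hp.
have [|q [qi [w hw]]] := infinite_pigeonhole (k := k) (c := v).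
  by move=> i; rewrite -(hv i id).
exists (a \o q); first exact: increasing_comp.
exists w => f fi; rewrite -(hw (f 0)) -(colv (q \o f)); last exact: increasing_comp.
by rewrite /mkseq -!map_comp.
Qed.

(** * Adjacent points and twins *)

Definition infinitely_many (E : eqType) (Q : E -> Prop) :=
  forall L : seq E, exists2 y, Q y & y \notin L.

Lemma not_infinitely_many (E : eqType) (Q : E -> Prop) :
  ~ infinitely_many Q -> exists L : seq E, forall y, Q y -> y \in L.
Proof.
move=> /existsNP[L hL]; exists L => y Qy.
by apply/negPn/negP => yL; apply: hL; exists y.
Qed.

Lemma infinitely_many_sub (E : eqType) (Q Q' : E -> Prop) :
  (forall x, Q x -> Q' x) -> infinitely_many Q -> infinitely_many Q'.
Proof. by move=> QQ' Qinf L; have [y /QQ' Qy yL] := Qinf L; exists y. Qed.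

Section Adjacency.
Variables (E : eqType) (J : Type) (rl : J -> seq E -> Prop).
Implicit Types (A B Q : E -> Prop) (x y z : E) (s : seq E) (i : J).

Definition redirect x y z := if z == x then y else z.
Definition swap x y z := if z == x then y else if z == y then x else z.

Definition list_in A s := forall z, z \in s -> A z.

(** Two points are adjacent when the points outside the pair cannot tell them
    apart, and twins when exchanging them is an automorphism. Consecutive points
    of a chain are adjacent but not twins: adjacency sees a finite interval where
    twins see nothing. *)
Definition adj A x y := [/\ A x, A y, x != y &
  forall i s, list_in A s -> y \notin s -> rl i s = rl i (map (redirect x y) s)].

Definition twin A x y :=
  forall i s, list_in A s -> rl i s = rl i (map (swap x y) s).

Lemma list_in_map A B (f : E -> E) s :
  (forall z, A z -> B (f z)) -> list_in A s -> list_in B (map f s).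
Proof. by move=> fAB sA _ /mapP[z /sA/fAB ? ->]. Qed.

Lemma list_in_redirect A x y s : A y -> list_in A s -> list_in A (map (redirect x y) s).
Proof. by move=> Ay; apply: list_in_map => z Az; rewrite /redirect; case: ifP. Qed.

Lemma list_in_swap A x y s : A x -> A y -> list_in A s -> list_in A (map (swap x y) s).
Proof.
by move=> Ax Ay; apply: list_in_map => z Az; rewrite /swap; do 2?case: ifP.
Qed.

Lemma redirect_notin x y s : x != y -> x \notin map (redirect x y) s.
Proof.
move=> xy; apply/mapP => -[z _]; rewrite /redirect; case: eqP => [_ e|zx e].
  by rewrite e eqxx in xy.
by rewrite e in zx.
Qed.

Lemma redirect_notin_other x y z s : z != y -> z \notin s -> z \notin map (redirect x y) s.
Proof.
move=> zy zs; apply/mapP => -[w ws]; rewrite /redirect; case: eqP => [_ e|_ e].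
  by rewrite e eqxx in zy.
by rewrite e ws in zs.
Qed.

Lemma swapC x y : swap x y =1 swap y x.
Proof.
move=> z; rewrite /swap.
by case: (z =P x) => [<-|_]; case: (z =P y) => // <-.
Qed.

Lemma swapK x y : cancel (swap x y) (swap x y).
Proof.
move=> z; rewrite /swap; case: (z =P x) => [->|zx].
  by rewrite eqxx; case: eqP => // ->.
case: (z =P y) => [->|zy]; first by rewrite eqxx.
by do 2?case: eqP.
Qed.

Lemma swap_inj x y : injective (swap x y).
Proof. exact: can_inj (@swapK x y). Qed.

Lemma adjC A x y : adj A x y -> adj A y x.
Proof.
move=> [Ax Ay xy h]; split => //; first by rewrite eq_sym.
move=> i s sA xs; rewrite (h i (map (redirect y x) s)).
- rewrite -map_comp map_id_in // => z zs; rewrite /= /redirect.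
  case: (z =P y) => [->|_]; first by rewrite eqxx.
  by case: eqP => // zx; rewrite -zx zs in xs.
- exact: list_in_redirect.
- by apply: redirect_notin; rewrite eq_sym.
Qed.

Lemma twinC A x y : twin A x y -> twin A y x.
Proof. by move=> h i s sA; rewrite (h i s sA); congr rl; apply/eq_map/swapC. Qed.

Lemma twinxx A x : twin A x x.
Proof.
move=> i s sA; rewrite map_id_in // => z _; rewrite /swap.
by case: eqP => // ->.
Qed.

Lemma twin_trans A x y z : A x -> A y -> A z ->
  twin A x y -> twin A y z -> twin A x z.
Proof.
move=> Ax Ay Az xy yz; case: (x =P z) => [<-|/eqP nxz]; first exact: twinxx.
case: (x =P y) => [->//|/eqP nxy]; case: (y =P z) => [<-//|/eqP nyz].
move=> i s sA; have s1A := list_in_swap Ax Ay sA.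
have s2A := list_in_swap Ay Az s1A.
rewrite (xy i s sA) (yz i _ s1A) (xy i _ s2A).
congr rl; rewrite -!map_comp; apply: eq_map => w; rewrite /= /swap.
case: (w =P x) => [_|/eqP wx].
  by rewrite !eqxx (eq_sym z) (negPf nxz) (eq_sym z) (negPf nyz).
case: (w =P y) => [->|/eqP wy].
  by rewrite ?eqxx (negPf nyz) (negPf nxy) (negPf nxz) ?eqxx.
case: (w =P z) => [_|_]; last by rewrite !(negPf wy, negPf wx).
by rewrite (negPf wy) ?eqxx (eq_sym y) (negPf nxy).
Qed.

Lemma twin_adj A x y : A x -> A y -> x != y -> twin A x y -> adj A x y.
Proof.
move=> Ax Ay xy h; split => // i s sA ys; rewrite (h i s sA); congr rl.
apply/eq_in_map => z zs; rewrite /redirect /swap; case: eqP => // _.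
by case: eqP => // zy; rewrite -zy zs in ys.
Qed.

Lemma list_in_sub A B s : (forall z, A z -> B z) -> list_in A s -> list_in B s.
Proof. by move=> AB sA z /sA/AB. Qed.

Lemma adj_sub A B x y : (forall z, B z -> A z) -> B x -> B y ->
  adj A x y -> adj B x y.
Proof.
by move=> BA Bx By [_ _ xy h]; split => // i s /(list_in_sub BA) sA; apply: h.
Qed.

Lemma twin_sub A B x y : (forall z, B z -> A z) -> twin A x y -> twin B x y.
Proof. by move=> BA h i s /(list_in_sub BA); apply: h. Qed.

(** A fresh element of the clique serves as a buffer: the exchange of [x] and
    [y] is the composite of three one-point moves through it. *)
Lemma infinite_clique_twin A Q x y :
  (forall u v, Q u -> Q v -> u != v -> adj A u v) ->
  infinitely_many Q -> Q x -> Q y -> twin A x y.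
Proof.
move=> clique Qinf Qx Qy; case: (x =P y) => [->|/eqP xy]; first exact: twinxx.
move=> i s sA; have [z Qz] := Qinf [:: x, y & s].
rewrite !inE !negb_or => /and3P[zx zy zs].
have [yx xz yz] : [/\ y != x, x != z & y != z] by split; rewrite eq_sym.
have [_ Az _ xz_move] := clique _ _ Qx Qz xz.
have [_ Ax _ yx_move] := clique _ _ Qy Qx yx.
have [_ Ay _ zy_move] := clique _ _ Qz Qy zy.
rewrite (xz_move i s sA zs) yx_move ?redirect_notin //; last exact: list_in_redirect.
rewrite zy_move ?redirect_notin //; last by do 2!apply: list_in_redirect => //.
congr rl; rewrite -!map_comp; apply/eq_in_map => w ws.
have wz : w != z by apply: contraNneq zs => <-.
rewrite /= /redirect /swap; case: (w =P x) => [_|/eqP wx].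
  by rewrite (negPf zy) eqxx.
by case: (w =P y) => [_|_]; rewrite ?(negPf xz) ?(negPf wz).
Qed.

(** A fresh neighbour [l] of [x] takes the place of [x] while [y] is turned into
    [y'] by way of [x], and then gives the place back. *)
Lemma infinite_degree_nbrs A x y y' : infinitely_many (adj A x) ->
  adj A x y -> adj A x y' -> y != y' -> adj A y y'.
Proof.
move=> xinf xy xy' yy'; have [Ax Ay nxy _] := xy; have [_ Ay' nxy' xy'_move] := xy'.
split => // i s sA y's; have [l xl] := xinf [:: x, y, y' & s].
rewrite !inE !negb_or => /and4P[lx ly ly' ls].
have [_ Al _ xl_move] := xl; have [_ _ _ yx_move] := adjC xy.
have [_ _ _ lx_move] := adjC xl.
rewrite (xl_move i s sA ls) yx_move ?redirect_notin //; last 2 first.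
- exact: list_in_redirect.
- by rewrite eq_sym.
have yx : y != x by rewrite eq_sym.
rewrite xy'_move; last 2 first.
- by do 2!apply: list_in_redirect => //.
- by do 2!(apply: redirect_notin_other; rewrite ?(eq_sym y') //).
rewrite lx_move; last 2 first.
- by do 3!apply: list_in_redirect => //.
- by apply: redirect_notin.
congr rl; rewrite -!map_comp; apply/eq_in_map => w ws.
have wl : w != l by apply: contraNneq ls => <-.
rewrite /= /redirect; case: (w =P x) => [->|/eqP wx].
  by rewrite (negPf ly) (negPf lx) eqxx (negPf nxy).
case: (w =P y) => [_|_]; first by rewrite eqxx (eq_sym y') (negPf ly').
by rewrite (negPf wx) (negPf wl).
Qed.

Lemma infinite_degree_twin A x y : infinitely_many (adj A x) ->
  adj A x y -> twin A x y.
Proof.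
move=> xinf xy; apply: (@infinite_clique_twin A (fun z => z = x \/ adj A x z)).
- move=> u v [->|xu] [->|xv] //; first by rewrite eqxx.
    by move=> _; apply: adjC.
  exact: infinite_degree_nbrs xu xv.
- by apply: infinitely_many_sub xinf => z; right.
- by left.
- by right.
Qed.

(** The component of [x], in the impredicative form that makes an induction
    along a path a mere application. *)
Definition conn A x y :=
  forall Q, Q x -> (forall a b, Q a -> adj A a b -> Q b) -> Q y.

Lemma connxx A x : conn A x x. Proof. by []. Qed.

Lemma conn_adj A x y z : conn A x y -> adj A y z -> conn A x z.
Proof. by move=> xy yz Q Qx QS; apply: (QS y) => //; apply: xy. Qed.

Lemma adj_conn A x y : adj A x y -> conn A x y.
Proof. exact: conn_adj (@connxx A x). Qed.

Lemma conn_trans A x y z : conn A x y -> conn A y z -> conn A x z.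
Proof. by move=> xy yz; apply: (yz (conn A x)) => // a b; apply: conn_adj. Qed.

Lemma conn_sym A x y : conn A x y -> conn A y x.
Proof.
move=> xy; apply: (xy (fun z => conn A z x)); first exact: connxx.
by move=> a b ax /adjC/adj_conn ba; apply: conn_trans ax.
Qed.

Lemma conn_in A x y : A x -> conn A x y -> A y.
Proof. by move=> Ax xy; apply: (xy A) => // a b _ []. Qed.

(** A neighbour of [x] is a twin of [x], so it has infinite degree too and the
    argument propagates along paths. *)
Lemma infinite_degree_conn A x y : A x -> infinitely_many (adj A x) ->
  conn A x y -> twin A x y.
Proof.
move=> Ax xinf xy.
suff [] : A y /\ twin A x y by [].
apply: (xy (fun z => A z /\ twin A x z)); first by split => //; apply: twinxx.
move=> a b [Aa xa] ab; have [_ Ab _ _] := ab; split => //.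
apply: (twin_trans Ax Aa Ab xa); apply: infinite_degree_twin => //.
case: (x =P a) => [<-//|/eqP nxa].
have adjxa : adj A x a by apply: twin_adj.
move=> L; have [y0 xy0] := xinf (a :: L); rewrite inE negb_or => /andP[y0a y0L].
by exists y0 => //; apply: infinite_degree_nbrs adjxa xy0 _ => //; rewrite eq_sym.
Qed.

(** Composing transpositions of twins gives every finite piece of an injection
    that moves each point to a twin of it. *)
Lemma twin_injection (T : eqType) A (e f : T -> E) :
  injective e -> injective f -> (forall z : T, A (e z)) ->
  (forall z : T, A (f z)) -> (forall z : T, twin A (e z) (f z)) ->
  forall i (s : seq T), rl i (map e s) = rl i (map f s).
Proof.
move=> ei fi Ae Af ef i s.
suff [g [gi gA gt grl gs]] : exists g : E -> E, [/\ injective g,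
    forall x, A x -> A (g x), forall x, A x -> twin A x (g x),
    forall i' s', list_in A s' -> rl i' s' = rl i' (map g s') &
    {in s, forall z : T, g (e z) = f z}].
  rewrite (grl i (map e s)); last by move=> _ /mapP[z _ ->].
  by rewrite -map_comp; congr rl; apply/eq_in_map.
elim: s => [|z s [g [gi gA gt grl gs]]].
  exists id; split => // [x _|i' s' _]; [exact: twinxx|by rewrite map_id].
case: (boolP (z \in s)) => zs.
  by exists g; split => // w; rewrite inE => /orP[/eqP->|]; apply: gs.
have tw : twin A (g (e z)) (f z).
  by apply: (@twin_trans _ _ (e z)) => //; [apply: gA|apply/twinC/gt].
exists (swap (g (e z)) (f z) \o g); split.
- by apply: inj_comp => //; apply: swap_inj.
- by move=> x Ax /=; rewrite /swap; do 2?case: ifP => // _; do ?apply: gA.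
- move=> x Ax; rewrite /= /swap; case: ifP => [/eqP e1|_].
    apply: (@twin_trans _ _ (g x)) => //; [exact: gA|exact: gt|by rewrite e1].
  case: ifP => [/eqP e2|_]; last exact: gt.
  apply: (@twin_trans _ _ (g x)) => //; [exact: gA|exact: gA|exact: gt|].
  by rewrite e2; apply: twinC.
- move=> i' s' sA'; rewrite (grl i' s' sA') (tw i' (map g s')) -?map_comp //.
  exact: list_in_map gA sA'.
- move=> w; rewrite inE => /orP[/eqP->|ws]; first by rewrite /= /swap eqxx.
  rewrite /= (gs w ws) /swap; case: eqP => [e1|_].
    by move: e1; rewrite -(gs w ws) => /gi/ei wz; rewrite -wz ws in zs.
  by case: eqP => // /fi wz; rewrite -wz ws in zs.
Qed.

End Adjacency.

(** * Connected components under an oligomorphic group *)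

Section Oligomorphic.
Variables (E : eqType) (J : Type) (rl : J -> seq E -> Prop).
Implicit Types (A B : E -> Prop) (x y z : E) (s : seq E) (i : J) (f : E -> E).

Definition automorphism f := bijective f /\ forall i s, rl i (map f s) = rl i s.

(** Finitely many orbits of lists of each length: lists of length [n] with the
    same colour are in the same orbit. *)
Definition oligomorphic := forall n, exists k (col : seq E -> nat),
  (forall s, col s < k) /\
  forall s s', size s = n -> size s' = n -> col s = col s' ->
    exists2 f, automorphism f & map f s = s'.

Lemma auto_comp f g : automorphism f -> automorphism g -> automorphism (f \o g).
Proof.
move=> [fb frl] [gb grl]; split; first exact: bij_comp.
by move=> i s; rewrite map_comp frl grl.
Qed.

Lemma auto_inv f : automorphism f -> exists g, [/\ automorphism g, cancel f g & cancel g f].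
Proof.
move=> [[g fg gf] frl]; exists g; split => //; split; first by exists f.
by move=> i s; rewrite -frl mapK.
Qed.

Local Notation adjT := (adj rl [set: E]).
Local Notation connT := (conn rl [set: E]).
Local Notation twinT := (twin rl [set: E]).

Lemma map_redirect_inj (f : E -> E) x y s : injective f ->
  map (redirect (f x) (f y)) (map f s) = map f (map (redirect x y) s).
Proof.
move=> fi; rewrite -!map_comp; apply: eq_map => z.
by rewrite /= /redirect (inj_eq fi); case: ifP.
Qed.

Lemma auto_adj f x y : automorphism f -> adjT x y -> adjT (f x) (f y).
Proof.
move=> fa; have [fb frl] := fa; have fi := bij_inj fb; move=> [_ _ xy h].
split => //; first by rewrite (inj_eq fi).
move=> i s _ fys; have [g [_ fg gf]] := auto_inv fa.
have <- : map f (map g s) = s by rewrite mapK.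
rewrite map_redirect_inj // !frl; apply: h => //.
by apply: contraNN fys => /(map_f f); rewrite mapK.
Qed.

Lemma auto_conn f x y : automorphism f -> connT x y -> connT (f x) (f y).
Proof.
move=> fa xy; apply: (xy (fun z => connT (f x) (f z))) => // a b xa ab.
by apply: conn_adj xa _; apply: auto_adj.
Qed.

Hypothesis olig : oligomorphic.

(** There are only finitely many orbits of lists of length [n], so anything
    that is bounded on each single one is bounded uniformly. *)
Lemma uniform_bound n (P : seq E -> nat -> Prop) :
  (forall f s d, automorphism f -> P s d -> P (map f s) d) ->
  (forall s d d', d <= d' -> P s d -> P s d') ->
  exists D, forall s, size s = n -> (exists d, P s d) -> P s D.
Proof.
move=> Pauto Pmono; have [k [col [colk colP]]] := olig n.
have /choice[b hb] v : exists d, forall s, size s = n -> col s = v ->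
    (exists d, P s d) -> P s d.
  have [[s [sn sv [d sd]]]|no] :=
      pselect (exists s, [/\ size s = n, col s = v & exists d, P s d]).
    exists d => s' s'n s'v _; have [f fa <-] : exists2 f, automorphism f & map f s = s'.
      by apply: colP => //; rewrite sv.
    exact: Pauto.
  by exists 0 => s sn sv sd; case: no; exists s.
exists (\max_(v < k) b v) => s sn sd.
apply: Pmono (hb (col s) s sn erefl sd).
exact: (leq_bigmax (Ordinal (colk s))).
Qed.

Lemma adj_witness_bound : exists k, forall x y, x != y -> ~ adjT x y ->
  exists i s, [/\ size s <= k, y \notin s & rl i s <> rl i (map (redirect x y) s)].
Proof.
pose P (w : seq E) d := if w is [:: x; y] then
  exists i s, [/\ size s <= d, y \notin s & rl i s <> rl i (map (redirect x y) s)]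
  else False.
have [||D hD] := @uniform_bound 2 P.
- move=> f [//|x [//|y [|//]]] d fa [i [s [sd ys neq]]].
  have [fb frl] := fa; exists i, (map f s); split; first by rewrite size_map.
    by rewrite mem_map //; apply: bij_inj.
  by rewrite map_redirect_inj ?frl //; apply: bij_inj.
- move=> [//|x [//|y [|//]]] d d' dd' [i [s [sd ys neq]]].
  by exists i, s; split => //; apply: leq_trans dd'.
exists D => x y xy nadj; apply: (hD [:: x; y] erefl).
apply: contrapT => no; apply: nadj; split => // i s _ ys.
by apply: contrapT => neq; apply: no; exists (size s), i, s.
Qed.

Fixpoint ball d x y := if d is d'.+1 then
  exists z, ball d' x z /\ (z = y \/ adjT z y) else x = y.

Lemma ball_conn d x y : ball d x y -> connT x y.
Proof.
elim: d y => [y ->|d IH y [z [/IH xz []]]]; first exact: connxx.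
  by move=> <-.
exact: conn_adj.
Qed.

Lemma ball_bound : exists D, forall x y, connT x y -> ball D x y.
Proof.
pose P (w : seq E) d := if w is [:: x; y] then ball d x y else False.
have [||D hD] := @uniform_bound 2 P.
- move=> f [//|x [//|y [|//]]] d fa /=.
  elim: d y => [y -> //|d IH y [z [/IH xz zy]]].
  exists (f z); split => //; case: zy => [->|zy]; first by left.
  by right; apply: auto_adj.
- move=> [//|x [//|y [|//]]] d d' /subnK <- /= xy.
  by elim: (d' - d) => //= e IH; exists y; split => //; left.
exists D => x y xy; apply: (hD [:: x; y] erefl).
apply: (xy (fun z => exists d, ball d x z)); first by exists 0.
by move=> a b [d xa] ab; exists d.+1, a; split => //; right.
Qed.

(** A point of infinite degree is a twin of its whole component; when all
    degrees are finite, so are the balls, one of which is the component. *)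
Lemma component_dichotomy x :
  (exists L : seq E, forall y, connT x y -> y \in L) \/
  infinitely_many (connT x) /\ forall y, connT x y -> twinT x y.
Proof.
have [[y [xy yinf]]|no] := pselect (exists y, connT x y /\ infinitely_many (adjT y)).
  right; split.
    by apply: infinitely_many_sub yinf => z; apply: conn_adj.
  move=> z xz; have tw w : connT x w -> twinT y w.
    move=> xw; apply: infinite_degree_conn => //.
    exact: conn_trans (conn_sym xy) xw.
  by apply: (@twin_trans _ _ _ _ _ y) => //; [apply/twinC/tw|apply: tw].
left; have [D hD] := ball_bound.
suff [L hL] : exists L : seq E, forall y, ball D x y -> y \in L.
  by exists L => y /hD/hL.
elim: D {hD} => [|d [L hL]]; first by exists [:: x] => y /= ->; rewrite inE.
have /choice[N hN] z : exists M : seq E, ball d x z -> forall y, adjT z y -> y \in M.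
  have [zinf|/not_infinitely_many[M hM]] := pselect (infinitely_many (adjT z)).
    by exists [::] => /ball_conn xz; case: no; exists z.
  by exists M.
exists (L ++ flatten (map N L)) => y [z [xz zy]]; rewrite mem_cat.
case: zy => [<-|zy]; first by rewrite hL.
apply/orP; right; apply/flattenP; exists (N z); first exact/map_f/hL.
exact: hN zy.
Qed.

Lemma component_bound : exists D, forall x,
  (exists L : seq E, forall y, connT x y -> y \in L) ->
  exists2 L : seq E, size L <= D & forall y, connT x y -> y \in L.
Proof.
pose P (w : seq E) d := if w is [:: x] then
  exists2 L : seq E, size L <= d & forall y, connT x y -> y \in L else False.
have [||D hD] := @uniform_bound 1 P.
- move=> f [//|x [|//]] d fa [L Ld hL]; exists (map f L); first by rewrite size_map.
  have [g [ga fg gf]] := auto_inv fa.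
  move=> y xy; rewrite -(gf y); apply/map_f/hL; rewrite -(fg x).
  exact: auto_conn.
- by move=> [//|x [|//]] d d' dd' [L Ld hL]; exists L => //; apply: leq_trans dd'.
exists D => x [L hL]; apply: (hD [:: x] erefl).
by exists (size L), L.
Qed.

End Oligomorphic.

Section ComponentSizes.
Variables (E : eqType) (J : Type) (rl : J -> seq E -> Prop).
Implicit Types (A B : E -> Prop) (x y z : E) (s : seq E) (i : J) (f : E -> E).

(** Isomorphism of the substructures induced on [A] and on [B]. *)
Definition isoset A B := exists f g, [/\ forall x, A x -> B (f x),
  forall y, B y -> A (g y), forall x, A x -> g (f x) = x,
  forall y, B y -> f (g y) = y &
  forall i s, list_in A s -> rl i (map f s) = rl i s].

Definition comp_size A n := exists x (L : seq E),
  [/\ A x, uniq L, size L = n & forall y, y \in L <-> conn rl A x y].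

Lemma isoset_adj A B f g : (forall x, A x -> B (f x)) ->
  (forall y, B y -> A (g y)) -> (forall x, A x -> g (f x) = x) ->
  (forall y, B y -> f (g y) = y) ->
  (forall i s, list_in A s -> rl i (map f s) = rl i s) ->
  forall x y, adj rl A x y -> adj rl B (f x) (f y).
Proof.
move=> fA gB fg gf frl x y [Ax Ay xy h]; split; [exact: fA|exact: fA| |].
  by apply: contra_neq xy => e; rewrite -(fg x) // e fg.
move=> i s sB fys.
have [s' s'A sE] : exists2 s', list_in A s' & s = map f s'.
  exists (map g s); first exact: list_in_map gB sB.
  by rewrite -map_comp map_id_in // => z /sB/gf.
rewrite sE (frl i s' s'A) (h i s' s'A); last first.
  by apply: contraNN fys => /(map_f f); rewrite -sE.
rewrite -frl; last exact: list_in_redirect.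
congr rl; rewrite -!map_comp; apply/eq_in_map => z zs'.
rewrite /= /redirect; case: (z =P x) => [->|zx]; first by rewrite eqxx.
by case: eqP => // e; case: zx; rewrite -(fg x) // -e fg //; apply: s'A.
Qed.

Lemma comp_size_iso A B n : isoset A B -> comp_size A n -> comp_size B n.
Proof.
move=> iAB; have [f [g [fA gB fg gf frl]]] := iAB => -[x [L [Ax uL sL hL]]].
have LA y : y \in L -> A y by move=> /hL/(conn_in Ax).
have grl i s : list_in B s -> rl i (map g s) = rl i s.
  move=> sB; rewrite -frl; last exact: list_in_map gB sB.
  by rewrite -map_comp map_id_in // => z /sB/gf.
exists (f x), (map f L); split; first exact: fA.
- by rewrite map_inj_in_uniq // => y z /LA Ay /LA Az e; rewrite -(fg y) // e fg.
- by rewrite size_map.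
move=> y; split => [/mapP[z /hL xz ->]|fxy].
  apply: (xz (fun z => conn rl B (f x) (f z))) => // a b xa ab.
  by apply: conn_adj xa _; apply: (isoset_adj fA gB).
have [By xgy] : B y /\ conn rl A x (g y); last first.
  by rewrite -(gf y By); apply/map_f/hL.
apply: (fxy (fun y => B y /\ conn rl A x (g y))).
  by rewrite fg //; split => //; apply: fA.
move=> a b [Ba xa] ab; have [_ Bb _ _] := ab; split => //.
by apply: conn_adj xa _; apply: (isoset_adj gB fA).
Qed.

End ComponentSizes.

(** * An order-indiscernible sequence over a copy of the structure *)

Section LimitSequence.
Variables (E : eqType) (J : Type) (rl : J -> seq E -> Prop).
Implicit Types (A B : E -> Prop) (x y z : E) (s : seq E) (i : J) (f : E -> E).
Local Notation adjT := (adj rl [set: E]).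
Local Notation connT := (conn rl [set: E]).
Local Notation twinT := (twin rl [set: E]).
Local Notation aut := (automorphism rl).

Lemma auto_twin f x y : aut f -> twinT (f x) (f y) <-> twinT x y.
Proof.
suff aux g u v : aut g -> twinT u v -> twinT (g u) (g v).
  move=> fa; split => [|/(aux _ _ _ fa)//].
  by have [g [ga fg _]] := auto_inv fa; move=> /(aux _ _ _ ga); rewrite !fg.
move=> ga uv i s _; have [h [ha gh hg]] := auto_inv ga.
have [gb grl] := ga; have sE : s = map g (map h s) by rewrite mapK.
rewrite sE grl (uv i (map h s)) // -grl; congr rl.
rewrite -!map_comp; apply: eq_map => z; rewrite /= /swap !(can_eq gh).
by do 2?case: ifP.
Qed.

Variables (index : E -> nat) (index_inj : injective index).
Hypothesis olig : oligomorphic rl.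
Hypothesis many_twins : forall L : seq E, exists y,
  forall x, x \in L -> ~ twinT x y.

(** Start from a sequence [b] of pairwise non-twins. Ramsey's theorem yields
    nested subsequences [b \o G n] whose increasing [n]-tuples all lie in one orbit
    over the first [n] points of [E]. The automorphisms [F n] are chosen so that
    each stage keeps the images of the previous one, although [F n.+1] is applied
    to a sparser subsequence; the stable values of [F n] on [E] and on the
    subsequences are [e] and [c]. If [c j] were a twin of [e z] then, by
    indiscernibility, so would be the next term, and two terms of [c] would be
    twins. *)
Lemma limit_sequence : exists (e : E -> E) (c : nat -> E),
  [/\ forall s, exists2 f, aut f & {in s, f =1 e},
      forall s n h, increasing h -> exists f, [/\ aut f,
        forall z, z \in s -> f (e z) = e z &
        forall j, j < n -> f (c j) = c (h j)],
      forall z j, ~ twinT (e z) (c j) &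
      forall j k, j < k -> ~ twinT (c j) (c k)].
Proof.
have [x0 _] := many_twins [::].
have [en enK] := partial_inverse x0 index_inj.
have [b b_twin] : exists b : nat -> E, forall j k, j < k -> ~ twinT (b j) (b k).
  have [//||b hb] := @dependent_choice_seq E (fun=> True)
      (fun l x => forall z, z \in l -> ~ twinT z x).
    by move=> l _; have [y hy] := many_twins l; exists y.
  exists b => j k jk; have [_] := hb k; apply.
  by apply/mapP; exists j; rewrite // mem_iota.
pose homog n (g : nat -> nat) := forall h, increasing h -> exists2 f, aut f &
  forall l, l < n -> f (en l) = en l /\ f (b (g l)) = b (g (h l)).
have [G hG] : exists G : nat -> nat -> nat, forall n,
    (increasing (G n) /\ homog n (G n)) /\
    exists2 r, increasing r & G n.+1 = G n \o r.
  apply: (@dependent_choice_step _ (fun n g => increasing g /\ homog n g)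
    (fun n g g' => exists2 r, increasing r & g' = g \o r)).
    exists id; split => // h _; exists id => //; split; first by exists id.
    by move=> i s; rewrite map_id.
  move=> n g [gi _]; have [k [col [colk colP]]] := olig (n.+1 + n.+1).
  pose tup (s : seq nat) := mkseq en n.+1 ++ map (b \o g) s.
  have [|r ri [v hv]] := @ramsey n.+1 k (fun s : seq nat => col (tup s)).
    by move=> s; apply: colk.
  exists (g \o r); last by exists r.
  split; first exact: increasing_comp.
  move=> h hi; have [||| f fa] :=
      colP (tup (map r (mkseq id n.+1))) (tup (map r (mkseq h n.+1))).
  - by rewrite size_cat !size_map !size_iota.
  - by rewrite size_cat !size_map !size_iota.
  - by rewrite (hv id) // (hv h).
  move=> /eqP; rewrite /tup map_cat eqseq_cat ?size_map //.
  rewrite /mkseq -!map_comp => /andP[/eqP/eq_in_map fen /eqP/eq_in_map fb].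
  by exists f => // l ln; split; [apply: fen|apply: fb]; rewrite mem_iota.
have [F hF] : exists F : nat -> E -> E, forall n, aut (F n) /\
    forall l, l < n -> F n.+1 (en l) = F n (en l) /\
                       F n.+1 (b (G n.+1 l)) = F n (b (G n l)).
  apply: (@dependent_choice_step _ (fun n => aut) (fun n f f' =>
    forall l, l < n -> f' (en l) = f (en l) /\ f' (b (G n.+1 l)) = f (b (G n l)))).
    exists id; split; first by exists id.
    by move=> i s; rewrite map_id.
  move=> n f fa; have [[gi hom] [r ri ->]] := hG n.
  have [u ua hu] := hom r ri; have [w [wa uw _]] := auto_inv ua.
  exists (f \o w); first exact: auto_comp.
  move=> l ln; have [uen ub] := hu l ln.
  by rewrite /= -{1}uen -ub !uw.
pose e z := F (index z).+1 z; pose c l := F l.+1 (b (G l.+1 l)).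
have Fe n z : index z < n -> F n z = e z.
  elim: n => // n IH; rewrite ltnS leq_eqVlt => /orP[/eqP <-//|zn].
  by have [_ /(_ _ zn)[+ _]] := hF n; rewrite enK => ->; apply: IH.
have Fc n l : l < n -> F n (b (G n l)) = c l.
  elim: n => // n IH; rewrite ltnS leq_eqVlt => /orP[/eqP <-//|ln].
  by have [_ /(_ _ ln)[_ ->]] := hF n; apply: IH.
have Fauto n : aut (F n) by have [] := hF n.
have c_twin j k : j < k -> ~ twinT (c j) (c k).
  move=> jk; rewrite -(Fc k.+1 j) 1?ltnW // -(Fc k.+1 k) //.
  move/(auto_twin _ _ (Fauto _)); apply: b_twin.
  by have [[+ _] _] := hG k.+1; apply.
have indisc s n h : increasing h -> exists f, [/\ aut f,
    forall z, z \in s -> f (e z) = e z & forall j, j < n -> f (c j) = c (h j)].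
  move=> hi; have [B hB] := seq_bound index s.
  pose m := maxn B (h n); have [[gi hom] _] := hG m.
  have [u ua hu] := hom h hi; have [w [wa Fw wF]] := auto_inv (Fauto m).
  exists (F m \o u \o w); split; first by do 2!apply: auto_comp => //.
    move=> z zs; have zm : index z < m by rewrite leq_max hB.
    by rewrite -!(Fe m) //= Fw; have [+ _] := hu _ zm; rewrite enK => ->.
  move=> j jn; have jm : j < m.
    by rewrite leq_max orbC (leq_trans jn) // increasing_le.
  have hjm : h j < m by rewrite leq_max orbC hi.
  by rewrite -!(Fc m) //= Fw; have [_ ->] := hu _ jm.
exists e, c; split => // [s|z j zj].
  have [B hB] := seq_bound index s.
  by exists (F B) => // z /hB; apply: Fe.
have [f [fa fz fc]] := indisc [:: z] j.+1 S increasing_succ.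
apply: (c_twin j j.+1) => //; move/(auto_twin _ _ fa): (zj).
rewrite fz ?mem_head // fc // => zj1.
by apply: (@twin_trans _ _ _ _ _ (e z)) => //; apply: twinC.
Qed.

End LimitSequence.

(** * Pairwise non-isomorphic siblings *)

Section Siblings.
Variables (E : eqType) (J : Type) (rl : J -> seq E -> Prop).
Implicit Types (A B : E -> Prop) (x y z w : E) (s : seq E) (i : J) (f g : E -> E).
Local Notation adjT := (adj rl [set: E]).
Local Notation connT := (conn rl [set: E]).
Local Notation twinT := (twin rl [set: E]).
Local Notation aut := (automorphism rl).

Lemma finite_component A x (L0 : seq E) :
  (forall y, conn rl A x y -> y \in L0) ->
  exists L : seq E, [/\ uniq L, size L <= size L0 &
    forall y, y \in L <-> conn rl A x y].
Proof.
move=> hL0; exists [seq y <- undup L0 | `[< conn rl A x y >]]; split.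
- by rewrite filter_uniq // undup_uniq.
- by rewrite size_filter (leq_trans (count_size _ _)) // size_undup.
- move=> y; rewrite mem_filter mem_undup.
  by split => [/andP[/asboolP]//|xy]; rewrite hL0 // andbT; apply/asboolP.
Qed.

Definition embeds_in A := exists f, [/\ injective f, forall z, A (f z) &
  forall i s, rl i (map f s) = rl i s].

(** The finite components have size at most [D], except for some whose size is
    close to [n]: this tells apart sets with distant values of [n]. *)
Definition has_large_component D n A :=
  (exists2 m, n <= m <= n + D & comp_size rl A m) /\
  forall m, comp_size rl A m -> m <= D \/ n <= m <= n + D.

Definition infinite_twin_class x :=
  infinitely_many (connT x) /\ forall y, connT x y -> twinT x y.

Hypothesis olig : oligomorphic rl.

Section TrimmedClass.
Variables (x : E).
Hypothesis x_inf : infinite_twin_class x.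

Lemma swap_auto y z : connT x y -> connT x z -> aut (swap y z).
Proof.
move=> xy xz; split; first by exists (swap y z); apply: swapK.
have [_ tw] := x_inf; move=> i s.
have yz : twinT y z.
  by apply: (@twin_trans _ _ _ _ _ x) => //; [apply/twinC/tw|apply: tw].
by rewrite -(yz i s).
Qed.

Definition trim (F : seq E) y := ~ connT x y \/ y \in F.

(** Exchanging twins, one point of [l] at a time; [F] is large enough to offer a
    free place each time. *)
Lemma push_into_trim (F : seq E) (l : seq E) u v : uniq F ->
  (forall y, y \in F -> connT x y) -> size l + 2 < size F ->
  trim F u -> trim F v ->
  exists f, [/\ aut f, f u = u, f v = v & forall z, z \in l -> trim F (f z)].
Proof.
move=> Funiq FD + Au Av; elim: l => [_|z l IH szF].
  exists id; split => //; split; first by exists id.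
  by move=> i s; rewrite map_id.
have [f [fa fu fv fl]] := IH (ltn_trans (ltnSn _) szF).
have [Afz|nAfz] := pselect (trim F (f z)).
  by exists f; split => // y; rewrite inE => /orP[/eqP->|/fl].
have Dfz : connT x (f z) by apply: contrapT => no; apply: nAfz; left.
have [t tF tN] : exists2 t, t \in F & t \notin [:: u, v & map f l].
  apply: contrapT => no; move: szF; rewrite ltnNge => /negP; apply.
  apply: leq_trans (uniq_leq_size Funiq (s2 := [:: u, v & map f l]) _) _.
    by move=> t tF; apply: contrapT => /negP tN; apply: no; exists t.
  by rewrite /= size_map addn2.
move: tN; rewrite !inE !negb_or => /and3P[tu tv tl].
have fixed y : trim F y -> y != t -> swap (f z) t y = y.
  move=> Ay yt; rewrite /swap (negPf yt); case: eqP => // yfz.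
  by rewrite yfz in Ay.
exists (swap (f z) t \o f); split.
- by apply: auto_comp => //; apply: swap_auto => //; apply: FD.
- by rewrite /= fu fixed // eq_sym.
- by rewrite /= fv fixed // eq_sym.
- move=> y; rewrite inE => /orP[/eqP->|yl]; first by right; rewrite /= /swap eqxx.
  rewrite /= fixed; [exact: fl|exact: fl|].
  by apply: contraNneq tl => <-; apply: map_f.
Qed.

(** Adjacency in [trim F] is the restriction of adjacency: a witness against
    the latter involves a bounded number of points, which automorphisms
    permuting the class of [x] bring inside [F]. *)
Lemma trim_large_component : exists N D, forall n, N <= n -> exists F : seq E,
  has_large_component D n (trim F).
Proof.
have [k hk] := adj_witness_bound olig; have [D hD] := component_bound olig.
exists k.+3, D => n kn; have [xinf xtwin] := x_inf.
have [F [Funiq Fsize FD]] : exists F : seq E, [/\ uniq F, size F = n &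
    forall y, y \in F -> connT x y].
  elim: n {kn} => [|n [F [Fu Fs FD]]]; first by exists [::].
  have [y xy yF] := xinf F; exists (y :: F); split; rewrite /= ?yF ?Fs //.
  by move=> z; rewrite inE => /orP[/eqP->|/FD].
exists F.
have adj_trim u v : adj rl (trim F) u v -> adjT u v.
  move=> [Au Av uv h]; apply: contrapT => /(hk u v uv)[i [s [sk vs]]].
  have [|f [fa fu fv fs]] := push_into_trim Funiq FD _ Au Av (l := s).
    by rewrite Fsize addn2; apply: leq_trans kn; rewrite !ltnS.
  have [fb frl] := fa; have fi := bij_inj fb; apply.
  rewrite -(frl i s) (h i (map f s)); last 2 first.
  - by move=> _ /mapP[z /fs Afz ->].
  - by rewrite -fv mem_map.
  by have := map_redirect_inj u v s fi; rewrite fu fv => ->; apply: frl.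
have conn_trim u v : conn rl (trim F) u v -> connT u v.
  move=> uv; apply: (uv (connT u)) => // a b ua /adj_trim; exact: conn_adj.
have compF u : u \in F -> forall y, y \in F <-> conn rl (trim F) u y.
  move=> uF y; split=> [yF|uy].
    case: (u =P y) => [->|/eqP uy]; first exact: connxx.
    apply: adj_conn; apply: twin_adj => //; [by right|by right|].
    apply: (@twin_sub _ _ _ [set: E]) => //.
    by apply: (@twin_trans _ _ _ _ _ x) => //; [apply: twinC|];
      apply: xtwin; apply: FD.
  apply: (uy (fun y => y \in F)) => // a b aF ab.
  have [_ [nDb|//] _ _] := ab; case: nDb.
  exact: conn_adj (FD _ aF) (adj_trim _ _ ab).
split.
  exists n; first by rewrite leqnn leq_addr.
  have [u uF] : exists u, u \in F.
    case: (F) Fsize kn => [<-//|u F' _ _]; by exists u; rewrite mem_head.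
  by exists u, F; split => //; [right|apply: compF].
move=> m [u [L [Au Lu Lm hL]]].
have [Du|nDu] := pselect (connT x u).
  have uF : u \in F by case: Au.
  right; suff -> : m = n by rewrite leqnn leq_addr.
  rewrite -Lm -Fsize; apply/perm_size/uniq_perm => // y.
  by apply/idP/idP => [/hL/(compF u uF)|/(compF u uF)/hL].
left; have [/hD[L' L'D hL']|[uinf utwin]] := component_dichotomy olig u.
  rewrite -Lm (leq_trans _ L'D) // uniq_leq_size // => y /hL/conn_trim.
  exact: hL'.
have [y uy] := uinf (u :: L); rewrite inE negb_or => /andP[yu /negP[]]; apply/hL.
have Ay : trim F y.
  by left => xy; apply: nDu; apply: conn_trans xy (conn_sym uy).
apply: adj_conn; apply: twin_adj; rewrite // 1?eq_sym //.
by apply: (@twin_sub _ _ _ [set: E]) => //; apply: utwin.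
Qed.

End TrimmedClass.

Section OrderedExtension.
Variables (index : E -> nat) (index_inj : injective index).
Variables (e : E -> E) (c : nat -> E).
Hypothesis e_auto : forall s, exists2 f, aut f & {in s, f =1 e}.
Hypothesis c_indisc : forall s n h, increasing h -> exists f, [/\ aut f,
        forall z, z \in s -> f (e z) = e z &
        forall j, j < n -> f (c j) = c (h j)].
Hypothesis e_c_twin : forall z j, ~ twinT (e z) (c j).
Hypothesis c_c_twin : forall j k, j < k -> ~ twinT (c j) (c k).

Lemma e_rl i s : rl i (map e s) = rl i s.
Proof.
have [f [_ frl] fe] := e_auto s; rewrite -(frl i s); congr rl.
by apply/eq_in_map => z /fe.
Qed.

Lemma e_inj : injective e.
Proof.
move=> y z; have [f [fb _] fe] := e_auto [:: y; z].
by rewrite -!fe ?inE ?eqxx ?orbT // => /(bij_inj fb).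
Qed.

Lemma e_twin y z : twinT (e y) (e z) <-> twinT y z.
Proof.
have [f fa fe] := e_auto [:: y; z].
by rewrite -!fe ?inE ?eqxx ?orbT //; apply: auto_twin.
Qed.

Lemma e_conn y z : connT y z -> connT (e y) (e z).
Proof.
have [f fa fe] := e_auto [:: y; z].
by rewrite -!fe ?inE ?eqxx ?orbT //; apply: auto_conn.
Qed.

Lemma e_neq_c z j : e z != c j.
Proof. by apply/eqP => ezc;
  apply: (e_c_twin (z := z) (j := j)); rewrite ezc; apply: twinxx. Qed.

Lemma c_inj : injective c.
Proof.
move=> j k cjk; case: (ltngtP j k) => // /c_c_twin[]; rewrite cjk; exact: twinxx.
Qed.

Lemma c_move (Z : seq E) n h1 h2 : increasing h1 -> increasing h2 ->
  exists f, [/\ aut f, forall z, z \in Z -> f (e z) = e z &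
    forall j, j < n -> f (c (h1 j)) = c (h2 j)].
Proof.
move=> /(c_indisc Z n)[f1 [f1a f1Z f1c]] /(c_indisc Z n)[f2 [f2a f2Z f2c]].
have [g [ga fg gf]] := auto_inv f1a.
exists (f2 \o g); split; first exact: auto_comp.
- by move=> z zZ; rewrite /= -{1}(f1Z z zZ) fg f2Z.
- by move=> j jn; rewrite /= -f1c // fg f2c.
Qed.

Definition ext n y := (exists z, y = e z) \/ (exists2 j, j < n & y = c j).

Lemma ext_e n z : ext n (e z). Proof. by left; exists z. Qed.

Lemma ext_c n j : j < n -> ext n (c j). Proof. by move=> jn; right; exists j. Qed.

Lemma ext_sub m n y : m <= n -> ext m y -> ext n y.
Proof.
by move=> mn [[z ->]|[j jm ->]]; [apply: ext_e|apply/ext_c/(leq_trans jm)].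
Qed.

Lemma ext_e_adj n y z : adj rl (ext n) (e y) (e z) -> adjT y z.
Proof.
move=> [_ _ yz h]; split => //; first by apply: contra_neq yz => ->.
move=> i s _ zs; rewrite -e_rl h.
- by rewrite map_redirect_inj ?e_rl //; apply: e_inj.
- by move=> _ /mapP[u _ ->]; apply: ext_e.
- by rewrite mem_map //; apply: e_inj.
Qed.

Lemma increasing_bump j : increasing (bump j).
Proof. by move=> u v uv; rewrite ltnNge leq_bump2 -ltnNge. Qed.

(** Consecutive terms of an order-indiscernible sequence are adjacent: moving
    one to the next is an increasing change of indices as long as the next one
    is not in use. *)
Lemma ext_c_adj n j : j.+1 < n -> adj rl (ext n) (c j) (c j.+1).
Proof.
move=> jn; split; [by apply/ext_c/ltnW|exact: ext_c| |].
  by apply/eqP => /c_inj/eqP; rewrite eqn_leq ltnn andbF.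
move=> i s sA cs.
have /choice[p hp] y : exists z, (exists z, y = e z) -> y = e z.
  have [[z yz]|no] := pselect (exists z, y = e z); first by exists z.
  by exists y => /no.
have [f [[fb frl] fs fc]] := c_move (map p s) n (@increasing_bump j.+1) (@increasing_bump j).
rewrite -(frl i s); congr rl; apply/eq_in_map => y ys.
case: (sA y ys) => [yz|[l ln yl]].
  rewrite {1}(hp y yz) fs ?map_f // -(hp y yz) /redirect.
  by case: eqP => // yc; case/eqP: (e_neq_c (p y) j); rewrite -(hp y yz).
have lj : l != j.+1 by apply: contraNneq cs => <-; rewrite -yl.
rewrite yl /redirect (inj_eq c_inj); case: (ltngtP l j) => [lj'|jl|->].
- by rewrite -{1}[l]/(false + l) -(ltn_geF (ltnW lj' : l < j.+1)) fc // /bump (ltn_geF lj').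
- case: l jl ln {yl} lj => // l; rewrite ltnS eqSS => jl ln lj.
  have jl' : j < l by rewrite ltn_neqAle eq_sym lj.
  by have := fc l (ltnW ln); rewrite /bump jl' jl !add1n.
- by have := fc j (ltnW jn); rewrite /bump ltnn leqnn add0n add1n.
Qed.

Lemma ext_conn_c n j : j < n -> conn rl (ext n) (c 0) (c j).
Proof.
elim: j => [_|j IH jn]; first exact: connxx.
exact: conn_adj (IH (ltnW jn)) (ext_c_adj jn).
Qed.

(** Over the copy of [E], both [y] and [z] look like new points, and all new
    points look alike. *)
Lemma ext_nbrs_adj n y z j k : j < n -> k < n ->
  adj rl (ext n) (e y) (c j) -> adj rl (ext n) (e z) (c k) -> y != z ->
  adjT y z.
Proof.
move=> jn kn [_ _ _ yj_move] /adjC[_ _ _ kz_move] yz.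
split => // i s _ zs.
have cs l : c l \notin map e s.
  by apply/mapP => -[u _ /esym/eqP]; rewrite (negPf (e_neq_c u l)).
have sA : list_in (ext n) (map e s) by move=> _ /mapP[u _ ->]; apply: ext_e.
have [f [[fb frl] fs fc]] := c_move s 1 (h1 := addn j) (h2 := addn k)
  (fun u v uv => etrans (ltn_add2l _ _ _) uv) (fun u v uv => etrans (ltn_add2l _ _ _) uv).
have := fc 0 isT; rewrite !addn0 => fjk.
rewrite -e_rl (yj_move i _ sA (cs j)) -frl.
have -> : map f (map (redirect (e y) (c j)) (map e s)) = map (redirect (e y) (c k)) (map e s).
  rewrite -!map_comp; apply/eq_in_map => u us; rewrite /= /redirect.
  by case: ifP => // _; rewrite fs.
rewrite kz_move.
- rewrite -[RHS]e_rl; congr rl; rewrite -!map_comp; apply/eq_in_map => u us.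
  rewrite /= /redirect (inj_eq e_inj); case: (u =P y) => [_|_]; first by rewrite eqxx.
  by rewrite (negPf (e_neq_c u k)).
- by apply: list_in_redirect => //; apply: ext_c.
- by apply: redirect_notin_other; [apply: e_neq_c|rewrite mem_map //; apply: e_inj].
Qed.

(** A class of twins survives in every set of points that contains its copy. *)
Lemma ext_infinite_degree n w : infinite_twin_class w ->
  infinitely_many (adj rl (ext n) (e w)).
Proof.
move=> [winf wtwin] L.
have /choice[p hp] y : exists z, forall z', y = e z' -> z = z'.
  have [[z ->]|no] := pselect (exists z, y = e z); first by exists z => z' /e_inj.
  by exists y => z' yz'; case: no; exists z'.
have [z wz] := winf (w :: map p L); rewrite inE negb_or => /andP[zw zL].
exists (e z); last by apply: contraNN zL => /(map_f p); rewrite (hp (e z) z).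
apply: twin_adj; [exact: ext_e|exact: ext_e|by rewrite (inj_eq e_inj) eq_sym|].
apply: (@twin_sub _ _ _ [set: E]) => //.
exact/e_twin/wtwin.
Qed.

(** At a bad [n] the new points only enlarge an infinite class of twins. *)
Definition bad n := exists2 w, infinite_twin_class w &
  adj rl (ext n) (e w) (c 0).

Lemma bad_twin n w y : infinite_twin_class w ->
  conn rl (ext n) (e w) y -> twin rl (ext n) (e w) y.
Proof.
by move=> /(ext_infinite_degree n); apply: infinite_degree_conn; apply: ext_e.
Qed.

Lemma ext_conn_e n z y : conn rl (ext n) (e z) y ->
  conn rl (ext n) (e z) (c 0) \/ exists2 z', connT z z' & y = e z'.
Proof.
move=> zy; suff [] : conn rl (ext n) (e z) y /\ (conn rl (ext n) (e z) (c 0) \/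
   exists2 z', connT z z' & y = e z') by [].
apply: (zy (fun y => conn rl (ext n) (e z) y /\ (conn rl (ext n) (e z) (c 0) \/
   exists2 z', connT z z' & y = e z'))); first by split => //; right; exists z.
move=> a b [za ha] ab; have zb := conn_adj za ab; split => //.
case: ha => [|[z' zz' az']]; first by left.
have [_ [[z'' bz'']|[j jn bj]] _ _] := ab.
  right; exists z'' => //; rewrite az' bz'' in ab.
  exact: conn_adj zz' (ext_e_adj ab).
left; rewrite bj in zb; exact: conn_trans zb (conn_sym (ext_conn_c jn)).
Qed.

(** The new points form one component together with at most one component of
    the copy of [E], by [ext_nbrs_adj]; unless [n] is bad, the latter is finite.
    The finite components that avoid the new points lie within finite components
    of the copy. *)
Lemma ext_large_component D n :
  (forall x, (exists L : seq E, forall y, connT x y -> y \in L) ->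
     exists2 L : seq E, size L <= D & forall y, connT x y -> y \in L) ->
  0 < n -> ~ bad n -> has_large_component D n (ext n).
Proof.
move=> hD n0 nbad.
have [Lw LwD hLw] : exists2 Lw : seq E, size Lw <= D &
    forall y, conn rl (ext n) (c 0) y -> y \in map c (iota 0 n) ++ map e Lw.
  have [[w [l ln wl]]|no] := pselect (exists w, exists2 l, l < n & adj rl (ext n) (e w) (c l)).
    have wc0 : conn rl (ext n) (e w) (c 0).
      exact: conn_trans (adj_conn wl) (conn_sym (ext_conn_c ln)).
    have [/hD[Lw LwD hLw]|winf] := component_dichotomy olig w; last first.
      case: nbad; exists w => //; apply: twin_adj (bad_twin winf wc0).
      - exact: ext_e.
      - exact: ext_c.
      - exact: e_neq_c.
    exists Lw => // y cy; rewrite mem_cat.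
    suff : (exists2 j, j < n & y = c j) \/ (exists2 z, connT w z & y = e z).
      move=> [[j jn ->]|[z wz ->]]; first by rewrite map_f // mem_iota.
      by rewrite (map_f e (hLw _ wz)) orbT.
    apply: (cy (fun y => (exists2 j, j < n & y = c j) \/ (exists2 z, connT w z & y = e z))).
      by left; exists 0.
    move=> a b ha ab; have [_ [[z bz]|bc] _ _] := ab; last by left.
    right; exists z => //; rewrite bz in ab; case: ha => [[j jn aj]|[u wu au]].
      case: (w =P z) => [->//|/eqP wz].
      rewrite aj in ab; exact: adj_conn (ext_nbrs_adj ln jn wl (adjC ab) wz).
    by rewrite au in ab; apply: conn_adj wu (ext_e_adj ab).
  exists [::] => // y cy; rewrite cats0.
  suff [j jn ->] : exists2 j, j < n & y = c j by rewrite map_f // mem_iota.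
  apply: (cy (fun y => exists2 j, j < n & y = c j)); first by exists 0.
  move=> a b [j jn aj] ab; have [_ [[z bz]|//] _ _] := ab.
  by case: no; exists z, j => //; apply: adjC; rewrite -aj -bz.
have main x L : uniq L -> (forall y, y \in L <-> conn rl (ext n) x y) ->
    conn rl (ext n) x (c 0) -> n <= size L <= n + D.
  move=> Lu hL xc; apply/andP; split.
    rewrite -[n](size_iota 0) -(size_map c) uniq_leq_size //.
      by rewrite map_inj_uniq ?iota_uniq //; apply: c_inj.
    move=> _ /mapP[j + ->]; rewrite mem_iota /= => jn.
    by apply/hL; apply: conn_trans xc (ext_conn_c jn).
  apply: (@leq_trans (size (map c (iota 0 n) ++ map e Lw))).
    apply: uniq_leq_size => // y /hL xy; apply: hLw.
    exact: conn_trans (conn_sym xc) xy.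
  by rewrite size_cat !size_map size_iota leq_add2l.
split.
  have [L [Lu _ hL]] := finite_component hLw.
  exists (size L); first by apply: (main (c 0)).
  by exists (c 0), L; split => //; apply: ext_c.
move=> m [x [L [Ax Lu <- hL]]].
have [xc|nxc] := pselect (conn rl (ext n) x (c 0)); first by right; apply: (main x).
left; case: Ax => [[z xz]|[j jn xj]]; last first.
  by case: nxc; rewrite xj; exact: conn_sym (ext_conn_c jn).
rewrite {}xz in hL nxc.
have [/hD[L' L'D hL']|zinf] := component_dichotomy olig z; last first.
  have [y /adj_conn zy /negP[]] := ext_infinite_degree n zinf L; exact/hL.
apply: leq_trans L'D; rewrite -(size_map e L'); apply: uniq_leq_size => // y.
by move=> /hL/ext_conn_e[//|[z' /hL' zz' ->]]; apply: map_f.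
Qed.

Lemma bad_mono m n : 0 < m <= n -> bad n -> bad m.
Proof.
move=> /andP[m0 mn] [w winf wc]; exists w => //.
apply: adj_sub wc => [y||]; [exact: ext_sub|exact: ext_e|exact: ext_c].
Qed.

(** If every [n] is bad, the bad class [w] is the same for all [n], and its copy
    together with the whole sequence [c] is a class of twins of [e E] and [c]
    together. Moving the class of [w] onto the terms of [c] is then an embedding,
    and it avoids the class of [e w] in [E] since no [c j] is a twin of [e w]. *)
Lemma bad_removable : (forall n, 0 < n -> bad n) ->
  exists2 x, infinite_twin_class x & embeds_in (fun y => ~ connT x y).
Proof.
move=> allbad; have [w winf wc] := allbad 1 isT.
pose extw y := exists n, ext n y.
have w_c l : twin rl extw (e w) (c l).
  move=> i s sA.
  have [n nl sn] : exists2 n, l < n & list_in (ext n) s.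
    have /choice[p hp] y : exists n, extw y -> ext n y.
      have [[n yn]|no] := pselect (extw y); first by exists n.
      by exists 0 => /no.
    have [B hB] := seq_bound p s; exists (maxn l.+1 B) => [|y ys].
      by rewrite leq_max ltnSn.
    apply: (ext_sub _ (hp y (sA y ys))).
    by rewrite leq_max orbC ltnW ?hB.
  have [w' w'inf w'c] := allbad n (leq_ltn_trans (leq0n _) nl).
  have n1 : 0 < n := leq_ltn_trans (leq0n _) nl.
  suff tw : twin rl (ext n) (e w) (c l) by apply: tw.
  apply: (@twin_trans _ _ _ _ _ (e w')); [exact: ext_e|exact: ext_e|exact: ext_c| |].
    apply: (@twin_sub _ _ _ [set: E]) => //; apply/e_twin.
    case: (w =P w') => [->|/eqP ww']; first exact: twinxx.
    have [_ + ] := winf; apply; apply: adj_conn.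
    apply: (@ext_nbrs_adj 1 _ _ 0 0) => //.
    by apply: adj_sub w'c => [y||]; [exact: ext_sub|exact: ext_e|exact: ext_c].
  apply: (bad_twin w'inf).
  exact: conn_trans (adj_conn w'c) (ext_conn_c nl).
have [win wtw] := winf.
have ew_inf : infinitely_many (connT (e w)).
  apply: infinitely_many_sub (ext_infinite_degree 0 winf) => y wy.
  have [_ [[u yu]|[j //]] _ _] := wy.
  by rewrite yu in wy *; apply: e_conn; apply: adj_conn (ext_e_adj wy).
have ew_conn z : connT (e w) z -> twinT (e w) z.
  have [[L hL]|[_]] := component_dichotomy olig (e w); last by apply.
  by have [y /hL yL /negP[]] := ew_inf L.
exists (e w); first by [].
pose f z := if `[< connT w z >] then c (index z) else e z.
have f_inj : injective f.
  move=> y z; rewrite /f; case: asboolP => wy; case: asboolP => wz.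
  - by move=> /c_inj/index_inj.
  - by move=> ce; case/eqP: (e_neq_c z (index y)).
  - by move=> ce; case/eqP: (e_neq_c y (index z)).
  - exact: e_inj.
exists f; split => //.
- move=> z; rewrite /f; case: asboolP => wz /ew_conn; first exact: e_c_twin.
  move=> /e_twin tw; apply: wz; case: (w =P z) => [->|/eqP wz]; first exact: connxx.
  by apply: adj_conn; apply: twin_adj.
- move=> i s; rewrite -[RHS]e_rl; apply/esym.
  apply: (@twin_injection _ _ _ _ extw) => //.
  + exact: e_inj.
  + by move=> z; exists 0; apply: ext_e.
  + by move=> z; rewrite /f; case: ifP => _;
      [exists (index z).+1; apply: ext_c|exists 0; apply: ext_e].
  + move=> z; rewrite /f; case: asboolP => wz; last exact: twinxx.
    apply: (@twin_trans _ _ _ _ _ (e w)) (w_c _).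
    * by exists 0; apply: ext_e.
    * by exists 0; apply: ext_e.
    * by exists (index z).+1; apply: ext_c.
    * by apply: (@twin_sub _ _ _ [set: E]) => //; apply/e_twin/twinC/wtw.
Qed.

End OrderedExtension.
Lemma embeds_in_sub A B : (forall x, A x -> B x) -> embeds_in A -> embeds_in B.
Proof. by move=> AB [f [fi fA frl]]; exists f; split => // z; apply: AB. Qed.

(** The sizes [n j] are spaced so that the intervals [[n j, n j + D]] are disjoint
    and lie above [D]: the large component of one set occurs in no other. *)
Theorem nonisomorphic_siblings (index : E -> nat) : injective index ->
  (forall L : seq E, exists y, forall x, x \in L -> ~ twinT x y) ->
  exists A : nat -> E -> Prop, (forall n, embeds_in (A n)) /\
    forall j k, j < k -> ~ isoset rl (A j) (A k).
Proof.
move=> index_inj many.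
have [N [D /choice[A hA]]] : exists N D, forall n, exists A, N <= n ->
    embeds_in A /\ has_large_component D n A.
  have [e [c [e_auto c_indisc e_c_twin c_c_twin]]] :=
    limit_sequence index_inj olig many.
  have [allbad|/existsNP[N /not_implyP[N0 Ngood]]] :=
      pselect (forall n, 0 < n -> bad e c n).
    have [x xinf xA] := bad_removable index_inj e_auto c_indisc e_c_twin c_c_twin allbad.
    have [N [D hD]] := trim_large_component xinf; exists N, D => n.
    have [Nn|nN] := boolP (N <= n); last by exists (fun=> True).
    have [F hF] := hD n Nn; exists (trim x F) => _; split => //.
    by apply: embeds_in_sub xA => y; left.
  have [D hD] := component_bound olig; exists N, D => n.
  exists (ext e c n) => Nn; split.
    exists e; split; [exact: e_inj e_auto|exact: ext_e|exact: e_rl e_auto].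
  apply: ext_large_component => //; first exact: leq_trans Nn.
  by move=> nbad; apply: Ngood; apply: bad_mono nbad; rewrite N0.
pose n j := N + D.+1 * j.+1.
have Nn j : N <= n j by rewrite leq_addr.
exists (A \o n); split => [j|j k jk jkiso]; first by have [] := hA _ (Nn j).
have [_ [[m /andP[nm mn] hm] _]] := hA _ (Nn j).
have [_ [_ /(_ m (comp_size_iso jkiso hm))]] := hA _ (Nn k).
have Dn : D < n j by rewrite /n mulnS addnA (leq_trans _ (leq_addr _ _)) ?leq_addl.
have nn : n j + D < n k.
  rewrite /n -addnA ltn_add2l.
  apply: leq_trans (leq_mul (leqnn D.+1) (jk : j.+2 <= k.+1)).
  by rewrite [X in _ < X]mulnS addnC ltn_add2r.
case=> [mD|/andP[km _]].
  by have := leq_ltn_trans (leq_trans nm mD) Dn; rewrite ltnn.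
by have := leq_ltn_trans (leq_trans km mn) nn; rewrite ltnn.
Qed.

End Siblings.

(** * Finitely many classes of twins *)

Section FinitelyManyTwins.
Variables (E : eqType) (J : Type) (rl : J -> seq E -> Prop).
Implicit Types (A B : E -> Prop) (x y z w : E) (s : seq E) (i : J) (f g : E -> E).
Local Notation twinT := (twin rl [set: E]).

Variables (L : seq E).
Hypothesis hL : forall y, exists2 x, x \in L & twinT x y.

Lemma twinT_trans x y z : twinT x y -> twinT y z -> twinT x z.
Proof. exact: twin_trans. Qed.

Section Embedding.
Variable f : E -> E.
Hypothesis f_inj : injective f.
Hypothesis f_rl : forall i s, rl i (map f s) = rl i s.

Lemma embedding_twin x y : twinT (f x) (f y) -> twinT x y.
Proof.
move=> fxy i s _; rewrite -f_rl (fxy i (map f s)) // -[RHS]f_rl; congr rl.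
rewrite -!map_comp; apply: eq_map => z; rewrite /= /swap !(inj_eq f_inj).
by do 2?case: ifP.
Qed.

(** An embedding permutes the finitely many classes of twins, for it maps
    inequivalent points to inequivalent ones; hence one of its powers fixes
    every class. *)
Lemma embedding_power : exists m, forall z, twinT z (iter m.+1 f z).
Proof.
have /choice[cl hcl] y : exists r : 'I_(size L), twinT (tnth (in_tuple L) r) y.
  by have [x /(tnthP (in_tuple L))[r ->] xy] := hL y; exists r.
pose V j := [ffun r : 'I_(size L) => cl (iter j f (tnth (in_tuple L) r))].
have [j [k [jk Vjk]]] : exists j k, j < k /\ V j = V k.
  apply: contrapT => no.
  have inj : injective (fun j : 'I_(#|{ffun 'I_(size L) -> 'I_(size L)}|.+1) => V j).
    move=> j k Vjk; apply/val_inj => /=; case: (ltngtP j k) => // jk; case: no.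
      by exists j, k.
    by exists k, j.
  by have := leq_card _ inj; rewrite card_ord ltnn.
have [m km] : exists m, k = j + m.+1.
  by exists (k - j).-1; rewrite prednK ?subn_gt0 // subnKC // ltnW.
have iter_twin n x y : twinT (iter n f x) (iter n f y) -> twinT x y.
  by elim: n => //= n IH /embedding_twin.
have clL x : x \in L -> twinT x (iter m.+1 f x).
  move=> xL; apply: (@iter_twin j); rewrite -iterD -km.
  have [r ->] : exists r, x = tnth (in_tuple L) r by apply/tnthP.
  have := congr1 (fun u : {ffun _} => u r) Vjk; rewrite !ffunE => e.
  apply: twinT_trans (hcl _); rewrite -e; exact: twinC.
exists m => z; have [y yL yz] := hL (iter m.+1 f z).
apply: (twinT_trans _ yz); apply: (@iter_twin m.+1).
exact: twinT_trans (twinC yz) (clL y yL).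
Qed.

(** Cantor-Bernstein between [A] and the whole set, with the inclusion of [A]
    as one of the two injections: the bijection it builds moves each point to
    itself or to its image under [g], hence to a twin. *)
Lemma embedding_onto A : (forall z, A (f z)) ->
  exists h, [/\ injective h, forall z, A (h z), forall a, A a -> exists z, h z = a &
    forall i s, rl i (map h s) = rl i s].
Proof.
move=> fA; have [m gtwin] := embedding_power; pose g := iter m.+1 f.
have gA z : A (g z) by apply: fA.
have g_inj : injective g by rewrite /g; elim: m.+1 => // n IH y z /f_inj/IH.
pose Z z := exists n u, ~ A u /\ z = iter n g u.
pose h z := if `[< Z z >] then g z else z.
have Zg z : Z z -> Z (g z) by move=> [n [u [nAu ->]]]; exists n.+1, u.
have h_inj : injective h.
  move=> y z; rewrite /h; case: asboolP => Zy; case: asboolP => Zz //.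
  - exact: g_inj.
  - by move=> e; case: Zz; rewrite -e; apply: Zg.
  - by move=> e; case: Zy; rewrite e; apply: Zg.
exists h; split => //.
- move=> z; rewrite /h; case: asboolP => // Zz.
  by apply: contrapT => nAz; apply: Zz; exists 0, z.
- move=> a Aa; have [[[|n] [u [nAu au]]]|nZa] := pselect (Z a).
  + by rewrite au in Aa.
  + by exists (iter n g u); rewrite /h; case: asboolP => // -[]; exists n, u.
  + by exists a; rewrite /h; case: asboolP.
- move=> i s; rewrite -[in RHS](map_id s); apply/esym.
  apply: (@twin_injection _ _ _ _ [set: E]) => // z.
  by rewrite /h; case: asboolP => _; [apply: gtwin|apply: twinxx].
Qed.

End Embedding.

End FinitelyManyTwins.

(** * First-order formulas and types *)

Section Formulas.
Variables (I : Type) (ar : I -> nat).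
Implicit Types R S : structure ar.

Definition Fnot n (p : formula ar n) := Fimp p (Fbot ar n).
Definition Fand n (p q : formula ar n) := Fnot (Fimp p (Fnot q)).
Definition Fex n (p : formula ar n.+1) := Fnot (Fall (Fnot p)).

Lemma holds_and R n (p q : formula ar n) (e : n.-tuple (dom R)) :
  holds (Fand p q) e <-> holds p e /\ holds q e.
Proof.
split=> [h|[hp hq] h]; last exact: h hp hq.
by split; apply: contrapT => no; apply: h => /= hp hq; apply: no.
Qed.

Lemma holds_ex R n (p : formula ar n.+1) (e : n.-tuple (dom R)) :
  holds (Fex p) e <-> exists a, holds p (cons_tuple a e).
Proof.
split=> [h|[a ha] h]; last exact: (h a).
by apply: contrapT => no; apply: h => a ha; apply: no; exists a.
Qed.

Lemma map_cons_tuple T U (f : T -> U) n (a : T) (e : n.-tuple T) :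
  map_tuple f (cons_tuple a e) = cons_tuple (f a) (map_tuple f e).
Proof. exact: val_inj. Qed.

Lemma isomorphism_sym R S (f : dom R -> dom S) : is_isomorphism f ->
  exists g, [/\ @is_isomorphism I ar S R g, cancel f g & cancel g f].
Proof.
move=> [[g fg gf] frel]; exists g; split => //; split; first by exists f.
move=> i t; rewrite frel; suff -> : map_tuple f (map_tuple g t) = t by [].
by apply: val_inj; rewrite /= mapK.
Qed.

Lemma isomorphism_holds R S (f : dom R -> dom S) n (p : formula ar n) e :
  is_isomorphism f -> holds p e <-> holds p (map_tuple f e).
Proof.
move=> [fb frel]; elim: p e => {n} [n|n x y|n i v|n p IHp q IHq|n p IHp] e //=.
- by rewrite !tnth_map; split => [->//|/(bij_inj fb)].
- rewrite frel; suff -> : map_tuple f (map_tuple (tnth e) v) =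
    map_tuple (tnth (map_tuple f e)) v by [].
  by apply: val_inj; rewrite /= -map_comp; apply: eq_map => j; rewrite /= tnth_map.
- by rewrite IHp IHq.
- split=> h a; last by rewrite IHp map_cons_tuple.
  by have [g fg gf] := fb; rewrite -(gf a) -map_cons_tuple -IHp.
Qed.

Definition lift_index m n (s : 'I_m -> 'I_n) (i : 'I_m.+1) : 'I_n.+1 :=
  if unlift ord0 i is Some j then lift ord0 (s j) else ord0.

Fixpoint rename m (p : formula ar m) : forall n, ('I_m -> 'I_n) -> formula ar n :=
  match p in formula _ m return forall n, ('I_m -> 'I_n) -> formula ar n with
  | Fbot m => fun n s => Fbot ar n
  | Feq m x y => fun n s => Feq ar (s x) (s y)
  | Frel m i v => fun n s => Frel (map_tuple s v)
  | Fimp m p q => fun n s => Fimp (rename p s) (rename q s)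
  | Fall m p => fun n s => Fall (rename p (lift_index s))
  end.

Definition reindex T m n (s : 'I_m -> 'I_n) (e : n.-tuple T) : m.-tuple T :=
  mktuple (tnth e \o s).

Lemma tnth_reindex T m n (s : 'I_m -> 'I_n) (e : n.-tuple T) j :
  tnth (reindex s e) j = tnth e (s j).
Proof. by rewrite tnth_mktuple. Qed.

Lemma holds_rename R m n (p : formula ar m) (s : 'I_m -> 'I_n)
    (e : n.-tuple (dom R)) :
  holds (rename p s) e <-> holds p (reindex s e).
Proof.
elim: p n s e => {m} [m|m x y|m i v|m p IHp q IHq|m p IHp] n s e //=.
- by rewrite !tnth_reindex.
- suff -> : map_tuple (tnth e) (map_tuple s v) =
    map_tuple (tnth (reindex s e)) v by [].
  by apply: val_inj; rewrite /= -map_comp; apply: eq_map => j; rewrite /= tnth_reindex.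
- by rewrite IHp IHq.
- suff E a : reindex (lift_index s) (cons_tuple a e) = cons_tuple a (reindex s e).
    by split=> h a; move: (h a); rewrite IHp E.
  apply: eq_from_tnth => j; rewrite tnth_reindex /= /lift_index.
  by case: unliftP => [k ->|->]; rewrite ?tnth0 // !tnthS tnth_reindex.
Qed.

Lemma exists_block k n (p : formula ar (k + n)) : exists q : formula ar n,
  forall R (e : n.-tuple (dom R)),
    holds q e <-> exists z : k.-tuple (dom R), holds p (cat_tuple z e).
Proof.
elim: k p => [|k IH] p.
  exists p => R e; have E : cat_tuple ([tuple] : 0.-tuple (dom R)) e = e by exact: val_inj.
  split=> [h|[z]]; first by exists [tuple]; rewrite E.
  by rewrite (tuple0 z) E.
have [q hq] := IH (Fex p); exists q => R e; rewrite hq.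
have E a (z : k.-tuple (dom R)) : cons_tuple a (cat_tuple z e) = cat_tuple (cons_tuple a z) e.
  exact: val_inj.
split=> [[z /holds_ex[a ha]]|[z hz]].
  by exists (cons_tuple a z); rewrite -E.
exists (behead_tuple z); apply/holds_ex; exists (thead z).
rewrite E; suff <- : z = cons_tuple (thead z) (behead_tuple z) by [].
by rewrite {1}[z]tuple_eta; apply: val_inj.
Qed.

Definition same_type R n (t t' : n.-tuple (dom R)) :=
  forall p : formula ar n, holds p t <-> holds p t'.

Definition isolated R n (t : n.-tuple (dom R)) :=
  exists2 p : formula ar n, holds p t & forall t', holds p t' -> same_type t t'.

Lemma same_type_reindex R m n (s : 'I_m -> 'I_n) (t t' : n.-tuple (dom R)) :
  same_type t t' -> same_type (reindex s t) (reindex s t').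
Proof. by move=> tt' p; rewrite -!holds_rename. Qed.

(** Quantify existentially over a tuple [z] that satisfies the isolating formula
    of [t] and has the given entries at the positions [s]. *)
Lemma isolated_reindex R m n (s : 'I_m -> 'I_n) (t : n.-tuple (dom R)) :
  isolated t -> isolated (reindex s t).
Proof.
move=> [p pt ph].
pose eqs (r : seq 'I_m) : formula ar (n + m) := foldr
  (fun i q => Fand (Feq ar (lshift m (s i)) (rshift n i)) q)
  (rename p (lshift m)) r.
have eqsP r (z : n.-tuple (dom R)) e : holds (eqs r) (cat_tuple z e) <->
    holds p z /\ forall i, i \in r -> tnth z (s i) = tnth e i.
  have zE : reindex (lshift m) (cat_tuple z e) = z.
    by apply: eq_from_tnth => i; rewrite tnth_reindex /= tnth_lshift.
  elim: r => [|i r IH]; first by rewrite holds_rename zE; split=> [|[]].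
  rewrite -[eqs _]/(Fand _ (eqs r)) holds_and IH /= tnth_lshift tnth_rshift.
  split=> [[zi [pz zr]]|[pz zr]].
    by split=> // j; rewrite inE => /orP[/eqP->|/zr].
  by split; [|split=> // j jr]; apply: zr; rewrite inE ?eqxx ?jr ?orbT.
have [q hq] := exists_block (eqs (enum 'I_m)); exists q.
  by apply/hq; exists t; apply/eqsP; split => // i _; rewrite tnth_reindex.
move=> t' /hq[z /eqsP[pz zt']].
suff -> : t' = reindex s z by apply: same_type_reindex (ph _ pz).
by apply: eq_from_tnth => i; rewrite tnth_reindex /= zt' // mem_enum.
Qed.

Lemma isolated_sub R m n (t : n.-tuple (dom R)) (t' : m.-tuple (dom R)) :
  isolated t -> (forall i, exists j, tnth t' i = tnth t j) -> isolated t'.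
Proof.
move=> ti /choice[s hs]; suff -> : t' = reindex s t by apply: isolated_reindex.
by apply: eq_from_tnth => i; rewrite tnth_reindex.
Qed.

End Formulas.

(** * Realizing sets of formulas *)

Lemma sval_inj T (P : T -> Prop) : injective (@proj1_sig T P).
Proof. by move=> [x Px] [y Py] /= xy; apply: eq_exist. Qed.

Section Models.
Variables (I : Type) (ar : I -> nat) (R : structure ar).
Variable x0 : dom R.
Hypothesis countable_relations : countable (relations R).

(** Up to equivalence in [R] there are only countably many formulas, although
    there may be uncountably many relation symbols. *)
Lemma formula_enumeration : exists D : nat -> seq (dom R) -> Prop,
  forall n (p : formula ar n), exists m, forall e : n.-tuple (dom R),
    holds p e <-> D m e.
Proof.
have /countable_injP[code code_inj] := countable_relations.
pose tagged i := existT (fun n => set (n.-tuple (dom R))) (ar i) (Defs.rel R i).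
pose on_list (r : {n : nat & set (n.-tuple (dom R))}) s :=
  exists2 t : (projT1 r).-tuple (dom R), projT2 r t & tval t = s.
pose op (k : nat * nat * seq nat) (args : seq (seq (dom R) -> Prop)) s : Prop :=
  let arg j := nth (fun=> False) args j in
  match k with
  | (0, _, _) => False
  | (1, _, v) => nth x0 s (nth 0 v 0) = nth x0 s (nth 0 v 1)
  | (2, a, v) => exists2 i, code (tagged i) = a & on_list (tagged i) (map (nth x0 s) v)
  | (3, _, _) => arg 0 s -> arg 1 s
  | _ => forall a, arg 0 (a :: s)
  end.
have [D hD] := closed_enumeration (fun=> False) op.
exists D => n p; elim: p => {n} [n|n x y|n i v|n p [a ha] q [b hb]|n p [a ha]].
- by have [m hm] := hD (0, 0, [::]) [::]; exists m => e; rewrite hm.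
- have [m hm] := hD (1, 0, [:: val x; val y]) [::]; exists m => e.
  by rewrite hm /= -!tnth_nth.
- have [m hm] := hD (2, code (tagged i), map val v) [::]; exists m => e.
  rewrite hm /= -map_comp.
  have -> : map (nth x0 e \o val) v = map_tuple (tnth e) v.
    by apply: eq_map => j; rewrite /= -tnth_nth.
  split=> [h|[j ji [t ht te]]].
    by exists i => //; exists (map_tuple (tnth e) v).
  have {ji} ji : tagged j = tagged i.
    by apply: code_inj ji; apply/mem_set; [exists j|exists i].
  have [t' ht' te'] : on_list (tagged i) (map_tuple (tnth e) v).
    by rewrite -ji; exists t.
  by rewrite -(val_inj te').
- have [m hm] := hD (3, 0, [::]) [:: a; b]; exists m => e.
  by rewrite hm /= ha hb.
- have [m hm] := hD (4, 0, [::]) [:: a]; exists m => e.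
  by rewrite hm /=; split=> h c; apply/(ha (cons_tuple c e))/h.
Qed.

Hypothesis all_models_isomorphic : forall S : structure ar,
  countable [set: dom S] -> models S (theory R) -> isomorphic R S.

(** The elements of the new model are sequences of points of [R], countably
    many but closed under Skolem functions, modulo an ultrafilter; the
    approximate solutions [t] of the given conditions yield a solution. *)
Lemma realize_type n (p : nat -> formula ar n) :
  (forall k, exists t : n.-tuple (dom R), forall j, j <= k -> holds (p j) t) ->
  exists t : n.-tuple (dom R), forall j, holds (p j) t.
Proof.
move=> /choice[t ht]; have [D hD] := formula_enumeration.
have /choice[pick hpick] (P : dom R -> Prop) : exists a, (exists a, P a) -> P a.
  by have [[a Pa]|no] := pselect (exists a, P a); [exists a|exists x0 => /no].
have [G [G_ultra G_tail]] := ultraFilterLemma eventually_filter.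
pose op (k : nat + nat) (args : seq (nat -> dom R)) j := match k with
  | inl k => nth x0 (t j) k
  | inr m => pick (fun a => ~ D m (a :: map (fun f => f j) args))
  end.
have [F hF] := closed_enumeration (fun=> x0) op.
pose equ l m := G [set j | F l j = F m j].
have equC l m : equ l m -> equ m l by apply: filterS => j.
pose T := {m : nat | forall l, l < m -> ~ equ l m}.
have /choice[rep hrep] m : exists r : T, equ (sval r) m.
  have ex : exists l, `[< equ l m >].
    by exists m; apply/asboolP; apply: filterS filterT.
  case: (ex_minnP ex) => l /asboolP lm lmin.
  have hl k : k < l -> ~ equ k l.
    move=> kl kEl; have := lmin k; rewrite leqNgt kl; move=> /(_ _)/negP[] //.
    by apply/asboolP; apply: filterS2 kEl lm => j /= -> ->.
  by exists (exist _ l hl).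
pose at_ j (x : T) := F (sval x) j.
pose S := @Structure I ar T (fun i u => G [set j | Defs.rel R i (map_tuple (at_ j) u)]).
have los m (q : formula ar m) (e : m.-tuple T) :
    @holds I ar S m q e <-> G [set j | holds q (map_tuple (at_ j) e)].
  elim: q e => {m} [m|m x y|m i v|m q IHq q' IHq'|m q IHq] e.
  - split=> // h; exact: (@filter_not_empty _ G).
  - rewrite /=; split=> [xy|h].
      by apply: filterS filterT => j _ /=; rewrite !tnth_map xy.
    have {h} xy : equ (sval (tnth e x)) (sval (tnth e y)).
      by apply: filterS h => j /=; rewrite !tnth_map.
    apply: sval_inj; case: (ltngtP (sval (tnth e x)) (sval (tnth e y))) => // lt.
      by case: (svalP (tnth e y) _ lt).
    by case: (svalP (tnth e x) _ lt); apply: equC.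
  - rewrite /=; suff E j : map_tuple (at_ j) (map_tuple (tnth e) v) =
        map_tuple (tnth (map_tuple (at_ j) e)) v.
      by split; apply: filterS => j /=; rewrite E.
    by apply: val_inj; rewrite /= -map_comp; apply: eq_map => k; rewrite /= tnth_map.
  - rewrite /=; split=> [h|h]; last first.
      by move=> /IHq hq; apply/IHq'; apply: filterS2 h hq => j /=; apply.
    have [hq|hq] := in_ultra_setVsetC [set j | holds q (map_tuple (at_ j) e)] G_ultra.
      by apply: filterS (iffLR (IHq' _) (h (iffRL (IHq _) hq))) => j /= hj _.
    by apply: filterS hq => j /= hj /hj.
  - rewrite /=; split=> [h|h a]; last first.
      by apply/IHq; apply: filterS h => j /= /(_ (at_ j a)); rewrite map_cons_tuple.
    have [d hd] := hD _ q; have [f hf] := hF (inr d) (map sval e).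
    have fr := hrep f.
    have := iffLR (IHq _) (h (rep f)).
    apply: filterS2 fr => j /= fr hj a; apply: contrapT => na.
    have : ~ D d (F f j :: map_tuple (at_ j) e).
      rewrite hf /= -!map_comp; apply: (hpick (fun a => ~ D d (a :: _))).
      by exists a => /(hd (cons_tuple a (map_tuple (at_ j) e))).
    apply; apply/(hd (cons_tuple (F f j) (map_tuple (at_ j) e))).
    by move: hj; rewrite map_cons_tuple /at_ fr.
have S_countable : countable [set: dom S].
  by apply/countable_injP; exists (fun x : T => sval x) => x y _ _ /sval_inj.
have S_models : models S (theory R).
  move=> q hq; apply/los; apply: filterS filterT => j _ /=.
  suff -> : map_tuple (at_ j) ([tuple] : 0.-tuple T) = [tuple] by [].
  exact: val_inj.
have [f f_iso] := all_models_isomorphic S_countable S_models.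
have [g [g_iso _ _]] := isomorphism_sym f_iso.
have /choice[b hb] (k : 'I_n) : exists m, F m = fun j => nth x0 (t j) k.
  by have [m hm] := hF (inl (val k)) [::]; exists m.
pose e := mktuple (fun k => rep (b k)).
exists (map_tuple g e) => i; rewrite -(isomorphism_holds _ _ g_iso); apply/los.
have near_t : G [set j | forall k, at_ j (tnth e k) = tnth (t j) k].
  apply: filter_forall => k; rewrite tnth_mktuple; apply: filterS (hrep (b k)) => j /=.
  by rewrite /at_ => ->; rewrite hb (tnth_nth x0).
have tail : G [set j | i <= j] by apply: G_tail; exists i.
apply: filterS2 near_t tail => j /= near_t ij.
suff -> : map_tuple (at_ j) e = t j by apply: ht.
by apply: eq_from_tnth => k; rewrite tnth_map near_t.
Qed.

End Models.

(** * Isolated types *)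

Section Isolated.
Variables (I : Type) (ar : I -> nat) (R : structure ar).
Variables (x0 : dom R) (index : dom R -> nat).
Hypothesis index_inj : injective index.
Hypothesis countable_relations : countable (relations R).
Hypothesis all_models_isomorphic : forall S : structure ar,
  countable [set: dom S] -> models S (theory R) -> isomorphic R S.

Lemma tuple_enumeration n : exists tup : nat -> n.-tuple (dom R),
  forall t, exists j, tup j = t.
Proof.
have h_inj : injective (fun t : n.-tuple (dom R) => pickle (map index t)).
  by move=> t t' /(pcan_inj pickleK)/(inj_map index_inj)/val_inj.
have [tup tupK] := partial_inverse (nseq_tuple n x0) h_inj.
by exists tup => t; exists (pickle (map index t)); apply: tupK.
Qed.

Let realize := @realize_type I ar R x0 countable_relations all_models_isomorphic.

(** Otherwise a consistent formula can be refined step by step so as to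
    exclude the tuples of [R] one after the other, and the limit is a set of
    conditions that is consistent but not realized. *)
Lemma dense_isolated n (p : formula ar n) :
  (exists t : n.-tuple (dom R), holds p t) ->
  exists2 t : n.-tuple (dom R), holds p t & isolated t.
Proof.
move=> p_sat; apply: contrapT => no; have [tup tup_surj] := tuple_enumeration n.
pose implies (q q' : formula ar n) := forall t : n.-tuple (dom R), holds q t -> holds q' t.
have [||F hF] := @dependent_choice_step (formula ar n)
  (fun _ q => (exists t : n.-tuple (dom R), holds q t) /\ implies q p)
  (fun j q q' => implies q' q /\ ~ holds q' (tup j)); first by exists p; split => // t.
  move=> j q [[t qt] qp].
  have [t' [qt' tt']] : exists t', holds q t' /\ ~ same_type t t'.
    apply: contrapT => all_same; apply: no; exists t; first exact: qp.
    exists q => // t' qt'; apply: contrapT => tt'; apply: all_same.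
    by exists t'.
  have [s [u [u' [qu [qu' [su su']]]]]] : exists (s : formula ar n) (u u' : n.-tuple (dom R)),
      holds q u /\ holds q u' /\ holds s u /\ ~ holds s u'.
    move/existsNP: tt' => [s st].
    have [st1|st1] := pselect (holds s t); have [st2|st2] := pselect (holds s t').
    - by case: st.
    - by exists s, t, t'.
    - by exists s, t', t.
    - by case: st.
  have [sj|sj] := pselect (holds s (tup j)).
    exists (Fand q (Fnot s)).
      by split; [exists u'; apply/holds_and|move=> v /holds_and[/qp]].
    by split=> [v /holds_and[//]|/holds_and[_ ns]]; exact: ns sj.
  exists (Fand q s).
    by split; [exists u; apply/holds_and|move=> v /holds_and[/qp]].
  by split=> [v /holds_and[//]|/holds_and[_ /sj]].
have F_mono j d : implies (F (j + d)) (F j).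
  elim: d => [|d IH] t; first by rewrite addn0.
  by rewrite addnS; have [_ [h _]] := hF (j + d) => /h; apply: IH.
have [k|t ht] := realize (p := F).
  have [[[t kt] _] _] := hF k; exists t => j jk; apply: (F_mono j (k - j)).
  by rewrite subnKC.
have [j jt] := tup_surj t; have [_ [_]] := hF j; apply; rewrite jt; apply: ht.
Qed.

(** A realization of an isolated type satisfying [p] may lie over another tuple
    than [t], but over one of the same type, which transfers the witness. *)
Lemma isolated_extension m n (t : n.-tuple (dom R)) (s : 'I_m -> 'I_n)
    (p : formula ar m.+1) :
  isolated t -> (exists y, holds p (cons_tuple y (reindex s t))) ->
  exists2 y, holds p (cons_tuple y (reindex s t)) & isolated (cons_tuple y t).
Proof.
move=> [q qt qh] [y py].
pose r := Fand (rename p (lift_index s)) (rename q (lift ord0)).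
have rP a (u : n.-tuple (dom R)) : holds r (cons_tuple a u) <->
    holds p (cons_tuple a (reindex s u)) /\ holds q u.
  rewrite holds_and !holds_rename.
  have -> : reindex (lift_index s) (cons_tuple a u) = cons_tuple a (reindex s u).
    apply: eq_from_tnth => j; rewrite tnth_reindex /= /lift_index.
    by case: unliftP => [k ->|->]; rewrite ?tnth0 // !tnthS tnth_reindex.
  suff -> : reindex (lift ord0) (cons_tuple a u) = u by [].
  by apply: eq_from_tnth => j; rewrite tnth_reindex tnthS.
have [|v rv [d dv dh]] := dense_isolated (p := r).
  by exists (cons_tuple y t); apply/rP.
have vE : v = cons_tuple (thead v) (behead_tuple v).
  by rewrite {1}[v]tuple_eta; apply: val_inj.
move: rv dv dh; rewrite {}vE; move: (thead v) (behead_tuple v) => a u rau da dh.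
have [_ qu] := iffLR (rP _ _) rau.
have [b hb] : exists b, holds d (cons_tuple b t).
  by apply/holds_ex; apply/(qh _ qu); apply/holds_ex; exists a.
exists b; first by have /rP[] := iffLR (dh _ hb r) rau.
exists d => // t' dt' q'; exact: iff_trans (iff_sym (dh _ hb q')) (dh _ dt' q').
Qed.

(** A Tarski-Vaught construction in which the finite parts are kept isolated. *)
Lemma atomic_enumeration : exists a : nat -> dom R,
  (forall n (s : n.-tuple nat), isolated (map_tuple a s)) /\
  forall n (p : formula ar n.+1) (s : n.-tuple nat),
    (exists y, holds p (cons_tuple y (map_tuple a s))) ->
    exists k, holds p (cons_tuple (a k) (map_tuple a s)).
Proof.
have [D hD] := formula_enumeration x0 countable_relations.
pose req (l : seq (dom R)) x := forall (m : nat) (s : seq nat) (k n : nat)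
    (p : formula ar n.+1) (s' : n.-tuple nat),
  size l = pickle (m, s, k) -> tval s' = s -> all (fun j => j < size l) s ->
  (forall e : n.+1.-tuple (dom R), holds p e <-> D m e) ->
  (exists y, holds p (cons_tuple y (map_tuple (nth x0 l) s'))) ->
  holds p (cons_tuple x (map_tuple (nth x0 l) s')).
have isolated_rcons (l : seq (dom R)) x :
    isolated (cons_tuple x (in_tuple l)) -> isolated (in_tuple (rcons l x)).
  move=> /isolated_sub; apply=> i; rewrite (tnth_nth x0) /= nth_rcons.
  case: ltnP => [il|li].
    by exists (lift ord0 (Ordinal il)); rewrite tnthS (tnth_nth x0).
  by exists ord0; rewrite tnth0 eqn_leq li -ltnS -(size_rcons l x) ltn_ord.
have [||a ha] := @dependent_choice_seq _ (fun l => isolated (in_tuple l)) req.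
- exists (Fnot (Fbot ar 0)) => // t' _ q.
  suff -> : t' = in_tuple [::] by [].
  by rewrite [t']tuple0 [RHS]tuple0.
- move=> l li.
  have [[m [s [k [n [p [s' [lE s's sl pD py]]]]]]]|no] :=
    pselect (exists (m : nat) (s : seq nat) (k n : nat)
      (p : formula ar n.+1) (s' : n.-tuple nat), [/\ size l = pickle (m, s, k),
      tval s' = s, all (fun j => j < size l) s,
      forall e : n.+1.-tuple (dom R), holds p e <-> D m e &
      exists y, holds p (cons_tuple y (map_tuple (nth x0 l) s'))]); last first.
    have [|x _ xl] := @isolated_extension 0 _ _ (fun i => widen_ord (leq0n _) i)
      (Fnot (Fbot ar 1)) li; first by exists x0.
    exists x; last exact: isolated_rcons.
    move=> m s k n p s' lE s's sl pD py; case: no.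
    by exists m, s, k, n, p, s'.
  have sl' i : tnth s' i < size l by apply: (allP sl); rewrite -s's mem_tnth.
  have argsE : map_tuple (nth x0 l) s' = reindex (fun i => Ordinal (sl' i)) (in_tuple l).
    by apply: eq_from_tnth => i; rewrite tnth_reindex tnth_map (tnth_nth x0).
  rewrite argsE in py; have [x px xl] := isolated_extension li py.
  exists x; last exact: isolated_rcons.
  move=> m2 s2 k2 n2 p2 s2' lE2 s2's _ p2D _.
  have [mE sE _] : [/\ m2 = m, s2 = s & k2 = k].
    by move: lE2; rewrite lE => /(pcan_inj pickleK)[-> -> ->].
  apply/p2D; rewrite -argsE in px; move/pD: px.
  by rewrite /= s2's s's sE mE.
exists a; split.
  move=> n s; have [B hB] := seq_bound id s; have [+ _] := ha B.
  move=> /isolated_sub; apply=> i; have iB : tnth s i < size (mkseq a B).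
    by rewrite size_mkseq; apply: hB; apply: mem_tnth.
  exists (Ordinal iB); rewrite tnth_map (tnth_nth x0) /= nth_mkseq //.
  by apply: hB; apply: mem_tnth.
move=> n p s [y hy]; have [m hm] := hD _ p.
have [B hB] := seq_bound id s; have [k Bk] := pickle_unbounded (m, tval s) B.
exists (pickle (m, tval s, k)); have [_ h] := ha (pickle (m, tval s, k)).
have sk : all (fun j => j < pickle (m, tval s, k)) s.
  by apply/allP => j /hB jB; apply: leq_trans Bk.
have sE : map_tuple (nth x0 (mkseq a (pickle (m, tval s, k)))) s = map_tuple a s.
  apply: val_inj; apply/eq_in_map => j js; rewrite nth_mkseq //; exact: (allP sk).
rewrite -sE in hy *; apply: (h m (tval s) k) => //; rewrite ?size_mkseq //.
by exists y.
Qed.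

(** The enumerated set is an elementary substructure, hence a copy of [R]. *)
Lemma all_isolated n (t : n.-tuple (dom R)) : isolated t.
Proof.
have [a [a_isolated a_closed]] := atomic_enumeration.
pose A x := exists k, a k = x.
pose S := restriction (R := R) A.
have elem m (p : formula ar m) (e : m.-tuple (dom S)) :
    @holds I ar S m p e <-> @holds I ar R m p (map_tuple (@proj1_sig _ A) e).
  elim: p e => {m} [m|m x y|m i v|m q IHq q' IHq'|m q IHq] e.
  - by [].
  - by rewrite /= !tnth_map; split=> [->//|/sval_inj].
  - rewrite /=; suff -> : map_tuple (@proj1_sig _ A) (map_tuple (tnth e) v) =
        map_tuple (tnth (map_tuple (@proj1_sig _ A) e)) v by [].
    by apply: val_inj; rewrite /= -map_comp; apply: eq_map => k; rewrite /= tnth_map.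
  - by rewrite /= IHq IHq'.
  - split=> /= h x; last by apply/IHq; rewrite map_cons_tuple; apply: h.
    apply: contrapT => nx.
    have /choice[s hs] i : exists k, a k = sval (tnth e i) by exact: (svalP (tnth e i)).
    have eE : map_tuple (@proj1_sig _ A) e = map_tuple a (mktuple s).
      by apply: eq_from_tnth => i; rewrite !tnth_map tnth_ord_tuple hs.
    have [|k nk] := a_closed _ (Fnot q) (mktuple s); first by exists x; rewrite -eE.
    apply: nk; rewrite -eE.
    have Ak : A (a k) by exists k.
    have /IHq := h (exist _ (a k) Ak : dom S).
    by rewrite map_cons_tuple.
have S_countable : countable [set: dom S].
  by apply/countable_injP; exists (index \o sval) => x y _ _ /index_inj/sval_inj.
have S_models : models S (theory R).
  move=> p hp; apply/elem; suff -> : map_tuple (@proj1_sig _ A)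
    ([tuple] : 0.-tuple (dom S)) = [tuple] by [].
  exact: val_inj.
have [f f_iso] := all_models_isomorphic S_countable S_models.
pose h (u : n.-tuple (dom R)) := map_tuple (@proj1_sig _ A) (map_tuple f u).
have h_holds p u : holds p u <-> holds p (h u).
  by rewrite (isomorphism_holds _ _ f_iso) elem.
have [s hs] : exists s : n.-tuple nat, h t = map_tuple a s.
  have /choice[s hs] i : exists k, a k = sval (f (tnth t i)) by exact: (svalP (f (tnth t i))).
  by exists (mktuple s); apply: eq_from_tnth => i; rewrite !tnth_map tnth_ord_tuple hs.
have [p pht hp] : isolated (h t) by rewrite hs.
exists p; first exact/h_holds.
move=> t' pt' q; have tt' := hp _ (iffLR (h_holds p t') pt').
exact: iff_trans (h_holds q t) (iff_trans (tt' q) (iff_sym (h_holds q t'))).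
Qed.

(** Otherwise the negations of the isolating formulas would be consistent, hence
    realized by a tuple whose own isolating formula is among them. *)
Lemma finitely_many_types n : exists L : seq (n.-tuple (dom R)),
  forall t : n.-tuple (dom R), exists2 j, j < size L & same_type t (nth t L j).
Proof.
have [tup tup_surj] := tuple_enumeration n.
have /choice[p hp] (t : n.-tuple (dom R)) : exists p : formula ar n,
    holds p t /\ forall t' : n.-tuple (dom R), holds p t' -> same_type t t'.
  by have [p] := all_isolated t; exists p.
apply: contrapT => no.
have [k|t ht] := realize (p := fun j => Fnot (p (tup j))); last first.
  have [j jt] := tup_surj t; apply: (ht j); rewrite jt; exact: proj1 (hp t).
move/forallNP: no => /(_ (mkseq tup k.+1)) /existsNP[t nt].
exists t => j jk ptj; apply: nt; exists j; first by rewrite size_mkseq ltnS.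
by rewrite nth_mkseq // => q; apply: iff_sym; apply: (proj2 (hp _)).
Qed.

End Isolated.

(** * Homogeneity and the Ryll-Nardzewski theorem *)

Section RyllNardzewski.
Variables (I : Type) (ar : I -> nat) (R : structure ar).
Local Notation E := {classic (dom R)}.

(** The relations of [R] as predicates on lists, of which there are none when
    the length differs from the arity. *)
Definition on_lists i (s : seq E) : Prop :=
  exists2 t : (ar i).-tuple (dom R), Defs.rel R i t & tval t = s.

Lemma on_lists_tuple i (t : (ar i).-tuple (dom R)) :
  on_lists i t = Defs.rel R i t.
Proof.
apply/propext; split=> [[t' ht /val_inj <-//]|ht]; by exists t.
Qed.

Lemma on_lists_size i (s : seq E) : on_lists i s -> size s = ar i.
Proof. by move=> [t _ <-]; rewrite size_tuple. Qed.

Variables (x0 : dom R) (index : dom R -> nat).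
Hypothesis index_inj : injective index.
Hypothesis countable_relations : countable (relations R).
Hypothesis all_models_isomorphic : forall S : structure ar,
  countable [set: dom S] -> models S (theory R) -> isomorphic R S.

Lemma same_type_sym n (t t' : n.-tuple (dom R)) :
  same_type t t' -> same_type t' t.
Proof. by move=> h p; apply: iff_sym. Qed.

Lemma same_type_extend n (t t' : n.-tuple (dom R)) x : same_type t t' ->
  exists y, same_type (cons_tuple x t) (cons_tuple y t').
Proof.
move=> tt'.
have [p px hp] := all_isolated x0 index_inj countable_relations
  all_models_isomorphic (cons_tuple x t).
have [y py] : exists y, holds p (cons_tuple y t').
  by apply/holds_ex; apply/tt'; apply/holds_ex; exists x.
by exists y; apply: hp.
Qed.

Definition matching (w : seq (E * E)) :=
  @same_type I ar R (size w) (map_tuple fst (in_tuple w)) (map_tuple snd (in_tuple w)).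

Lemma matching_of n (t t' : n.-tuple (dom R)) w : same_type t t' ->
  map fst w = t -> map snd w = t' -> matching w.
Proof.
move=> tt' wt wt'.
have wn : n = size w by rewrite -(size_tuple t) -wt size_map.
subst n; rewrite /matching.
have -> : map_tuple fst (in_tuple w) = t by apply: val_inj.
by have -> : map_tuple snd (in_tuple w) = t' by apply: val_inj.
Qed.

Lemma matching_eq w p p' : matching w -> p \in w -> p' \in w ->
  p.1 = p'.1 <-> p.2 = p'.2.
Proof.
move=> wm /(tnthP (in_tuple w))[i ->] /(tnthP (in_tuple w))[j ->].
by have := wm (Feq ar i j); rewrite /= !tnth_map.
Qed.

Lemma matching_on_lists w (s : seq (E * E)) i : matching w ->
  {subset s <= w} -> on_lists i (map fst s) = on_lists i (map snd s).
Proof.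
move=> wm sw; have [si|si] := pselect (size s = ar i); last first.
  apply/propext; split=> /on_lists_size; by rewrite size_map => /si.
have /eqP si' := si; pose u := Tuple si'.
have /choice[v hv] (k : 'I_(ar i)) : exists j, tnth u k = tnth (in_tuple w) j.
  by apply/tnthP/sw/mem_tnth.
have := wm (Frel (mktuple v)).
have E1 (f : E * E -> dom R) :
    map_tuple (tnth (map_tuple f (in_tuple w))) (mktuple v) = map_tuple f u.
  by apply: eq_from_tnth => k; rewrite !tnth_map tnth_ord_tuple hv.
rewrite /= !E1 => h.
have := on_lists_tuple (map_tuple fst u); have := on_lists_tuple (map_tuple snd u).
by rewrite /= => -> ->; apply/propext.
Qed.

(** Back and forth: the matching [F j] grows so that the [j]-th point of [E]
    enters on both sides. *)
Lemma same_type_auto n (t t' : n.-tuple (dom R)) : same_type t t' ->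
  exists2 f : E -> E, automorphism on_lists f & map f t = t'.
Proof.
move=> tt'; have [en enK] := partial_inverse x0 index_inj.
pose Z : seq (E * E) := zip t t'.
have [||F hF] := @dependent_choice_step (seq (E * E))
  (fun _ w => matching w /\ {subset Z <= w})
  (fun j w w' => exists x y, w' = [:: (en j : E, y), (x, en j : E) & w]).
- exists Z; split => //; apply: (matching_of tt').
    by apply: unzip1_zip; rewrite !size_tuple.
  by apply: unzip2_zip; rewrite !size_tuple.
- move=> j w [wm ws].
  have [x hx] := same_type_extend (en j) (same_type_sym wm).
  have wm1 : matching ((x, en j : E) :: w) by apply: matching_of (same_type_sym hx) _ _.
  have [y hy] := same_type_extend (en j) wm1.
  exists [:: (en j : E, y), (x, en j : E) & w]; last by exists x, y.
  split; first exact: matching_of hy _ _.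
  by move=> p /ws pw; rewrite !inE pw !orbT.
have F_matching j : matching (F j) by have [[]] := hF j.
have F_sub j k : j <= k -> {subset F j <= F k}.
  move=> /subnK <-; elim: (k - j) => // d IH p /IH pd.
  have [_ [x [y ->]]] := hF (d + j); by rewrite !inE pd !orbT.
have F_inj j k p p' : p \in F j -> p' \in F k -> p.1 = p'.1 <-> p.2 = p'.2.
  move=> /(F_sub _ _ (leq_maxl j k)) pj /(F_sub _ _ (leq_maxr j k)) pk.
  exact: matching_eq (F_matching _) pj pk.
have /choice[f hf] x : exists y, exists j, (x, y) \in F j.
  have [_ [x' [y Fx]]] := hF (index x); exists y, (index x).+1.
  by rewrite Fx enK mem_head.
have /choice[g hg] y : exists x, exists j, (x, y) \in F j.
  have [_ [x [y' Fx]]] := hF (index y); exists x, (index y).+1.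
  by rewrite Fx enK inE mem_head orbT.
exists f; last first.
  apply: (@eq_from_nth _ x0); first by rewrite size_map !size_tuple.
  move=> i; rewrite size_map => it; rewrite (nth_map x0) //.
  have [j xj] := hf (nth x0 t i); have [[_ zF] _] := hF 0.
  have zi : (nth x0 t i, nth x0 t' i) \in F 0.
    apply: zF; rewrite -nth_zip ?size_tuple // mem_nth //.
    by rewrite size1_zip ?size_tuple // -(size_tuple t).
  exact: (iffLR (F_inj _ _ _ _ xj zi)).
split.
  exists g => x.
    have [j xj] := hf x; have [k gk] := hg (f x).
    by have := iffRL (F_inj _ _ _ _ gk xj); apply.
  have [j xj] := hg x; have [k gk] := hf (g x).
  by have := iffLR (F_inj _ _ _ _ gk xj); apply.
move=> i s; pose w := [seq (x, f x) | x <- s].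
have [j wj] : exists j, {subset w <= F j}.
  have /choice[b hb] := hf; have [B hB] := seq_bound b s.
  exists B => _ /mapP[x xs ->]; apply: F_sub (hb x); exact/ltnW/hB.
have := matching_on_lists i (F_matching j) wj.
by rewrite -!map_comp map_id => <-.
Qed.

Theorem ryll_nardzewski : oligomorphic on_lists.
Proof.
move=> n; have [L hL] := finitely_many_types x0 index_inj countable_relations
  all_models_isomorphic n.
pose t0 : n.-tuple (dom R) := nseq_tuple n x0.
have /choice[col hcol] (s : seq E) : exists c, c <= size L /\
    forall t : n.-tuple (dom R), tval t = s -> same_type t (nth t0 L c).
  have [[t <-]|no] := pselect (exists t : n.-tuple (dom R), tval t = s); last first.
    by exists 0; split => // t ts; case: no; exists t.
  have [j jL tj] := hL t; exists j; split; first exact: ltnW.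
  by move=> t' /val_inj ->; rewrite (set_nth_default t).
exists (size L).+1, col; split=> [s|s s' sn s'n colss']; first by have [] := hcol s.
have [t ts] : exists t : n.-tuple (dom R), tval t = s.
  by move/eqP: sn => sn; exists (Tuple sn).
have [t' t's'] : exists t : n.-tuple (dom R), tval t = s'.
  by move/eqP: s'n => s'n; exists (Tuple s'n).
rewrite -ts -t's'; apply: same_type_auto.
have [_ /(_ t ts) h] := hcol s; have [_ /(_ t' t's') h'] := hcol s'.
move=> p; rewrite colss' in h; exact: iff_trans (h p) (iff_sym (h' p)).
Qed.

End RyllNardzewski.

(** * Siblings *)

Section Structures.
Variables (I : Type) (ar : I -> nat).
Implicit Types R S T : structure ar.

Definition is_embedding R S (f : dom R -> dom S) :=
  injective f /\
  forall i t, Defs.rel R i t <-> Defs.rel S i (map_tuple f t).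

Lemma map_tuple_comp (A B C : Type) (f : B -> C) (g : A -> B) n (t : n.-tuple A) :
  map_tuple f (map_tuple g t) = map_tuple (f \o g) t.
Proof. by apply: val_inj; rewrite /= map_comp. Qed.

Lemma isomorphism_comp R S T (f : dom R -> dom S) (g : dom S -> dom T) :
  is_isomorphism f -> is_isomorphism g -> @is_isomorphism I ar R T (g \o f).
Proof.
move=> [fb frel] [gb grel]; split; first exact: bij_comp.
by move=> i t; rewrite frel grel map_tuple_comp.
Qed.

Lemma isomorphic_refl R : isomorphic R R.
Proof.
exists id; split; first by exists id.
by move=> i t; suff -> : map_tuple id t = t by []; apply: val_inj; rewrite /= map_id.
Qed.

Lemma isomorphic_sym R S : isomorphic R S -> isomorphic S R.
Proof. by move=> [f /isomorphism_sym[g [giso _ _]]]; exists g. Qed.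

Lemma isomorphic_trans R S T : isomorphic R S -> isomorphic S T -> isomorphic R T.
Proof. by move=> [f fiso] [g giso]; exists (g \o f); apply: isomorphism_comp. Qed.

Lemma isomorphism_embedding R S (f : dom R -> dom S) : is_isomorphism f ->
  is_embedding f.
Proof. by move=> [fb frel]; split => //; apply: bij_inj. Qed.

Lemma embedding_comp R S T (f : dom R -> dom S) (g : dom S -> dom T) :
  is_embedding f -> is_embedding g -> @is_embedding R T (g \o f).
Proof.
move=> [fi frel] [gi grel]; split; first exact: inj_comp.
by move=> i t; rewrite frel grel map_tuple_comp.
Qed.

Lemma restriction_embedding R (A : set (dom R)) :
  @is_embedding (restriction A) R (@proj1_sig (dom R) A).
Proof. by split; first exact: sval_inj. Qed.

Lemma corestriction_embedding R S (f : dom R -> dom S) (A : set (dom S))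
    (fA : forall x, A (f x)) : is_embedding f ->
  @is_embedding R (restriction A) (fun x => exist _ (f x) (fA x)).
Proof.
move=> [fi frel]; split=> [x y [/fi]//|i t].
by rewrite frel /= map_tuple_comp.
Qed.

Lemma embedding_isomorphic R S (f : dom R -> dom S) (A : set (dom S)) :
  is_embedding f -> (forall x, A (f x)) -> (forall y, A y -> exists x, f x = y) ->
  isomorphic R (restriction A).
Proof.
move=> femb fA fonto; have [h_inj hrel] := corestriction_embedding fA femb.
exists (fun x => exist _ (f x) (fA x)); split => //.
have /choice[g hg] (y : dom (restriction A)) : exists x, f x = sval y.
  exact: fonto (svalP y).
have hgK : cancel g (fun x => exist _ (f x) (fA x) : dom (restriction A)).
  by move=> y; apply: sval_inj; rewrite /= hg.
by exists g => // x; apply: h_inj; rewrite hgK.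
Qed.

Lemma embedsP S R : embeds S R <-> exists f : dom S -> dom R, is_embedding f.
Proof.
split=> [[A [f fiso]]|[f femb]].
  exists (@proj1_sig (dom R) A \o f).
  exact: embedding_comp (isomorphism_embedding fiso) (@restriction_embedding R A).
exists (range f); apply: embedding_isomorphic femb _ _ => [x|y [x _ <-]]; by exists x.
Qed.

Variable R : structure ar.
Local Notation E := {classic (dom R)}.
Local Notation twinR := (twin (@on_lists I ar R) [set: E]).

Lemma embedding_on_lists (f : E -> E) : injective f ->
  (forall i s, on_lists i (map f s) = on_lists i s) -> @is_embedding R R f.
Proof.
move=> fi frl; split => // i t.
by have := frl i t; rewrite -on_lists_tuple -on_lists_tuple /= => ->.
Qed.

Lemma on_lists_embedding (f : E -> E) : @is_embedding R R f ->
  forall i s, on_lists i (map f s) = on_lists i s.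
Proof.
move=> [_ frel] i s; have [si|si] := pselect (size s = ar i).
  have /eqP si' := si; have /propext := frel i (Tuple si').
  by rewrite -!on_lists_tuple => h; apply/esym.
by apply/propext; split=> on_s; have := on_lists_size on_s; rewrite ?size_map => /si.
Qed.

(** Points of one block are twins, as their transposition preserves all blocks;
    conversely the classes of twins form a partition of the required kind, by
    [twin_injection]. *)
Lemma finitely_partitionableP : finitely_partitionable R <->
  exists L : seq E, forall y, exists2 x, x \in L & twinR x y.
Proof.
split=> [[P [/(finite_seqP (T := {classic (set (dom R))}))[Ls PE]]]|[L hL]].
  move=> [Pcov Ptriv Pne] Pauto.
  have [[x0 _]|no] := pselect (exists x0 : dom R, True); last first.
    by exists [::] => y; case: no; exists y.
  have /choice[pick hpick] (B : set (dom R)) : exists x, B !=set0 -> B x.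
    by have [[x Bx]|B0] := pselect (B !=set0); [exists x|exists x0 => /B0].
  exists (map pick Ls) => y.
  have [B PB By] : cover P id y by rewrite Pcov.
  exists (pick B); first by apply: map_f; have : P B := PB; rewrite PE.
  have Bx : B (pick B) by apply: hpick; exists y.
  move: (pick B) Bx => x Bx i s _; apply/esym/on_lists_embedding.
  apply: isomorphism_embedding; apply: Pauto.
    by exists (swap (x : E) y); apply: swapK.
  move=> B' PB'; have stable (z : E) : B' z -> B' (swap (x : E) y z).
    move=> B'z; rewrite /swap; case: (z =P x) => [zx|_].
      by rewrite (Ptriv B' B) //; exists x; split; rewrite // -zx.
    case: (z =P y) => [zy|//].
    by rewrite (Ptriv B' B) //; exists y; split; rewrite // -zy.
  apply/seteqP; split=> [_ [z /stable Bz <-//]|z /stable Bz].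
  by exists (swap (x : E) y z) => //; apply: (@swapK E x y z).
exists [set [set y | twinR x y] | x in [set` L]]; split.
- exact/finite_image/finite_seq.
- split.
  + apply/seteqP; split=> // y _; have [x xL xy] := hL y.
    by exists [set y | twinR x y] => //; exists x.
  + move=> _ _ [x _ <-] [x' _ <-] [z [xz x'z]].
    have xx' : twinR x x' by apply: twinT_trans xz (twinC x'z).
    apply/seteqP; split=> y; first exact/twinT_trans/twinC.
    exact: twinT_trans.
  + by move=> _ [x _ <-]; exists x; apply: twinxx.
move=> f fb fP; split => // i t.
have ftwin z : twinR z (f z).
  have [x xL xz] := hL z; pose B := [set y | twinR x y].
  have fB : f @` B = B by apply: fP; exists x.
  have Bfz : B (f z) by rewrite -fB; exists z.
  exact: twinT_trans (twinC xz) Bfz.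
have := @twin_injection E I (@on_lists I ar R) E [set: E] id f
  (fun _ _ => id) (bij_inj fb) (fun=> Logic.I) (fun=> Logic.I) ftwin i t.
by rewrite map_id -!on_lists_tuple => ->.
Qed.

Lemma finitely_partitionable_sib : finitely_partitionable R ->
  sib R = [set iso_class R].
Proof.
move=> /finitely_partitionableP[L hL].
have iso S : sibling R S -> isomorphic R S.
  move=> [[A [g giso]] /embedsP[f femb]].
  have [gi grel] := isomorphism_embedding giso.
  have fA x : A ((@proj1_sig (dom R) A \o (g \o f)) x) by exact: svalP.
  have femb' := embedding_comp (embedding_comp femb (isomorphism_embedding giso))
    (@restriction_embedding R A).
  have [h [hi hA honto hrl]] :=
    embedding_onto hL (proj1 femb') (on_lists_embedding femb') fA.
  have RA : isomorphic R (restriction A).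
    exact: embedding_isomorphic (embedding_on_lists hi hrl) hA honto.
  by apply: isomorphic_trans RA _; apply: isomorphic_sym; exists g.
have class_eq S : isomorphic R S -> iso_class S = iso_class R.
  move=> RS; apply/seteqP; split=> T; first exact: isomorphic_trans.
  by apply: isomorphic_trans; apply: isomorphic_sym.
apply/seteqP; split=> [_ [S /iso RS <-]|_ ->]; first exact: class_eq.
have [f fiso] := isomorphic_refl R.
by exists R => //; split; apply/embedsP; exists f; apply: isomorphism_embedding.
Qed.

Lemma isomorphic_isoset (A B : E -> Prop) :
  isomorphic (@restriction I ar R A) (@restriction I ar R B) ->
  isoset (@on_lists I ar R) A B.
Proof.
have extend (C D : E -> Prop) (h : {x | C x} -> {x | D x}) :
    exists f : E -> E, forall x Cx, f x = sval (h (exist _ x Cx)).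
  suff /choice[f hf] x : exists y, forall Cx, y = sval (h (exist _ x Cx)).
    by exists f.
  have [Cx|nCx] := pselect (C x); last by exists x.
  by exists (sval (h (exist _ x Cx))) => Cx'; rewrite (Prop_irrelevance Cx Cx').
move=> [h [[k hk kh] hrel]].
have [f hf] := extend _ _ h; have [g hg] := extend _ _ k.
exists f, g; split.
- by move=> x Ax; rewrite (hf _ Ax); apply: svalP.
- by move=> x Bx; rewrite (hg _ Bx); apply: svalP.
- move=> x Ax; rewrite (hf _ Ax); case E1 : (h _) => [y By] /=.
  by rewrite (hg _ By) -E1 hk.
- move=> x Bx; rewrite (hg _ Bx); case E1 : (k _) => [y Ay] /=.
  by rewrite (hf _ Ay) -E1 kh.
move=> i s sA; have [si|si] := pselect (size s = ar i); last first.
  by apply/propext; split=> on_s; have := on_lists_size on_s; rewrite ?size_map => /si.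
have /eqP si' := si; pose t := Tuple si'.
have /choice[u hu] (j : 'I_(ar i)) : exists y : {x | A x}, sval y = tnth t j.
  have Aj : A (tnth t j) by apply: sA; apply: (mem_tnth j t).
  by exists (exist _ _ Aj).
have hu_rel := propext (hrel i (mktuple u)); move: hu_rel => /=.
have -> : map_tuple (@proj1_sig _ A) (mktuple u) = t.
  by apply: eq_from_tnth => j; rewrite tnth_map tnth_mktuple hu.
have -> : map_tuple (@proj1_sig _ B) (map_tuple h (mktuple u)) = map_tuple f t.
  apply: eq_from_tnth => j; rewrite !tnth_map tnth_ord_tuple -hu.
  by case: (u j) => x Ax /=; rewrite (hf _ Ax).
by rewrite -!on_lists_tuple.
Qed.

Lemma infinite_sib (A : nat -> E -> Prop) :
  (forall n, embeds_in (@on_lists I ar R) (A n)) ->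
  (forall j k, j < k -> ~ isoset (@on_lists I ar R) (A j) (A k)) ->
  infinite_set (sib R).
Proof.
move=> A_emb A_iso; pose S n := @restriction I ar R (A n).
have S_sib n : sibling R (S n).
  split; first by exists (A n); apply: isomorphic_refl.
  have [f [fi fA frl]] := A_emb n.
  apply/embedsP; exists (fun x => exist _ (f x) (fA x)).
  exact: corestriction_embedding (embedding_on_lists fi frl).
have S_inj : injective (fun n => iso_class (S n)).
  suff lt j k : j < k -> iso_class (S j) <> iso_class (S k).
    move=> j k jkE; case: (ltngtP j k) => // jk; first by case: (lt _ _ jk).
    by case: (lt _ _ jk); rewrite jkE.
  move=> jk jkE; apply: (A_iso j k jk); apply: isomorphic_isoset.
  suff : iso_class (S j) (S k) by [].
  by rewrite jkE; apply: isomorphic_refl.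
move=> sib_fin; apply: infinite_nat.
have : finite_set ((fun n => iso_class (S n)) @` [set: nat]).
  by apply: sub_finite_set sib_fin => _ [n _ <-]; exists (S n); first exact: S_sib.
by rewrite (eq_finite_set (inj_card_eq _)) // => j k _ _ /S_inj.
Qed.

End Structures.

Theorem theorem1p1 (I : Type) (ar : I -> nat) (R : structure ar)
    (countable_R : countable [set: dom R])
    (countable_relations : countable (relations R))
    (categorical_R : aleph0_categorical R) :
  (sib R #= `I_1 \/ infinite_set (sib R)) /\
  (sib R #= `I_1 <-> finitely_partitionable R).
Proof.
have [fin|nfin] := pselect (finitely_partitionable R).
  have sib1 : sib R #= `I_1 by rewrite (finitely_partitionable_sib fin) card_set1.
  by split; [left|].
suff sib_inf : infinite_set (sib R).
  split; first by right.
  by split=> // sib1; case: sib_inf; apply/finite_setP; exists 1.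
have /countable_injP[index index_inj'] := countable_R.
have index_inj : injective index by move=> x y; apply: index_inj'; rewrite inE.
have many (L : seq {classic (dom R)}) : exists y, forall x, x \in L ->
    ~ twin (@on_lists I ar R) [set: _] x y.
  apply: contrapT => no; apply: nfin; apply/finitely_partitionableP; exists L => y.
  apply: contrapT => noy; apply: no; exists y => x xL xy; apply: noy; by exists x.
have [x0 _] := many [::].
have all_isomorphic S : countable [set: dom S] -> models S (theory R) -> isomorphic R S.
  move=> S_countable S_models; have [M [_ _ M_iso]] := categorical_R.
  apply: isomorphic_trans (M_iso S S_countable S_models).
  by apply: isomorphic_sym; apply: M_iso.
have [A [A_emb A_iso]] := nonisomorphic_siblings
  (ryll_nardzewski x0 index_inj countable_relations all_isomorphic) index_inj many.
exact: infinite_sib A_emb A_iso.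
Qed.
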